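(* For every positive integer $d$ there exists a constant $c(d)>0$, depending only on $d$, such that the following holds. Let $n\ge 1$, let $X,X_1,\ldots,X_n$ be independent identically distributed real random variables, let $a=(a_1,\ldots,a_n)$ with $a_k\in\mathbf{R}^d$, let $F_a$ be the distribution of $S_a=\sum_{k=1}^n X_k a_k$, and let $G$ be the distribution of the symmetrized random variable $\widetilde X=X_1-X_2$ (the difference of two independent copies of $X$). Let $V$ be an arbitrary Borel measure on $\mathbf{R}$ such that $\lambda=V\{\mathbf{R}\}>0$ and $V\le G$, that is, $V\{B\}\le G\{B\}$ for every Borel set $B\subset\mathbf{R}$, and put $F=\lambda^{-1}V$. Then, for any $\varepsilon>0$ and $\tau>0$, $$Q(F_a,\tau)\le c(d)\, Q(H_1^{\lambda},\varepsilon)\,\exp\bigg(d\int_{z\in\mathbf{R}}\log\big(1+\lfloor\tau(\varepsilon|z|)^{-1}\rfloor\big)\,F\{dz\}\bigg).$$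
   Context: For a probability distribution $F=\mathcal{L}(Y)$ of a random vector $Y$ in $\mathbf{R}^d$, the concentration function is $Q(F,\lambda)=\sup_{x\in\mathbf{R}^d}\mathbf{P}(Y\in x+\lambda B)$, $\lambda\ge 0$, where $B=\{x\in\mathbf{R}^d:\|x\|\le 1/2\}$ and $\|\cdot\|$ is the Euclidean norm. $\lfloor x\rfloor$ denotes the largest integer $k$ such that $k<x$ (strict inequality). In particular $\log(1+\lfloor\tau(\varepsilon|z|)^{-1}\rfloor)=0$ for $|z|\ge\tau/\varepsilon$. At $z=0$ the integrand is understood as $+\infty$; the integral may be infinite, in which case the right-hand side is $+\infty$. $H_1$ is the symmetric infinitely divisible distribution on $\mathbf{R}^d$ (depending on $a$) with characteristic function $\widehat H_1(t)=\exp\big(-\frac12\sum_{k=1}^n(1-\cos\langle t,a_k\rangle)\big)$, $t\in\mathbf{R}^d$. For $\lambda\ge 0$, $H_1^{\lambda}$ is the infinitely divisible distribution with characteristic function $\widehat H_1(t)^{\lambda}$ (powers in the convolution sense). *)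

(* Defs.v *)
From HB Require Import structures.
From mathcomp Require Import all_boot all_order all_algebra.
From mathcomp Require Import all_classical all_reals all_analysis.
From mathcomp.real_closed Require Export complex.
Set Implicit Arguments.
Unset Strict Implicit.
Unset Printing Implicit Defensive.
Import Order.TTheory GRing.Theory Num.Theory.
Import numFieldNormedType.Exports.
Local Open Scope classical_set_scope.
Local Open Scope ring_scope.

(* The carrier is ['rV[R]_d] itself, so vectors can be used directly at this
   type; the alias only selects the Borel sigma-algebra. *)
Definition borelRd (R : realType) (d : nat) :=
  g_sigma_algebraType (@open 'rV[R]_d).

Section euclidean.
Context {R : realType} {d : nat}.
Implicit Types x y : 'rV[R]_d.

Definition dotv x y : R := \sum_(i < d) x ord0 i * y ord0 i.

(* MathComp-Analysis equips ['rV[R]_d] with the sup norm, hence a separate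
   Euclidean norm. *)
Definition enorm x : R := Num.sqrt (dotv x x).

(* Radius 1/2, i.e. diameter 1. *)
Definition half_ball : set 'rV[R]_d := [set x | enorm x <= 2^-1].

Definition concentration (mu : set 'rV[R]_d -> \bar R) (r : R) : \bar R :=
  ereal_sup [set mu [set x + r *: b | b in half_ball] | x in [set: 'rV[R]_d]].

Definition charfun (mu : probability (borelRd R d) R) (t : 'rV[R]_d) : R[i] :=
  Complex (\int[mu]_x cos (dotv t x)) (\int[mu]_x sin (dotv t x)).

Definition charfun_H1 n (a : 'I_n -> 'rV[R]_d) (t : 'rV[R]_d) : R :=
  expR (- (2^-1 * \sum_(k < n) (1 - cos (dotv t (a k))))).

(* A probability law on R^d is determined by its characteristic function, so
   at most one [H] satisfies this. *)
Definition is_H1_power n (a : 'I_n -> 'rV[R]_d) (lambda : R)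
    (H : probability (borelRd R d) R) : Prop :=
  forall t : 'rV[R]_d, charfun H t = (charfun_H1 a t `^ lambda)%:C%C.

End euclidean.

Section random_variables.
Context {R : realType} {dO : measure_display} {Omega : measurableType dO}.
Variable P : probability Omega R.

Definition mutually_independent (I : finType) (X : I -> {RV P >-> R}) : Prop :=
  forall (J : {set I}) (B : I -> set R), (forall i, measurable (B i)) ->
    P (\bigcap_(i in [set` J]) (X i @^-1` B i)) =
    (\prod_(i in J) P (X i @^-1` B i))%E.

Definition identically_distributed (I : finType) (X : I -> {RV P >-> R}) :
    Prop :=
  forall (i j : I) (B : set R), measurable B ->
    distribution P (X i) B = distribution P (X j) B.

Definition iid (I : finType) (X : I -> {RV P >-> R}) : Prop :=
  mutually_independent X /\ identically_distributed X.

Definition weighted_sum d n (X : 'I_n -> {RV P >-> R}) (a : 'I_n -> 'rV[R]_d) :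
    Omega -> borelRd R d :=
  fun w => \sum_(k < n) X k w *: a k.

(* Under the product law the two coordinates are independent copies of [X]. *)
Definition symmetrized_law (X : {RV P >-> R}) : set R -> \bar R :=
  pushforward (distribution P X \x distribution P X)%E
    (fun z : R * R => z.1 - z.2 : R).

End random_variables.

Section truncation.
Context {R : realType}.

(* Meaningful only when [V setT] is finite and nonzero: [fine +oo = 0]. *)
Definition normalized (V : {measure set R -> \bar R}) :
    {measure set R -> \bar R} :=
  mscale (fine (V [set: R]))^-1%:nng V.

Definition strict_floor (x : R) : int := Num.ceil x - 1.

(* [strict_floor x] is the largest integer k such that k < x. *)
Lemma strict_floorP (x : R) (k : int) : (k%:~R < x) = (k <= strict_floor x).
Proof. by rewrite /strict_floor -ceil_gt_int -lezD1 lerBrDr. Qed.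

Definition log_ratio (tau eps z : R) : \bar R :=
  if z == 0 then +oo%E
  else (ln (1 + (strict_floor (tau * (eps * `|z|)^-1))%:~R))%:E.

End truncation.

(* Main.v *)
Require Import Defs.
From HB Require Import structures.
From mathcomp Require Import all_boot all_order all_algebra.
From mathcomp Require Import all_classical all_reals all_analysis.
From mathcomp Require Import measurable_realfun.
From mathcomp Require Import ring lra.
Set Implicit Arguments.
Unset Strict Implicit.
Unset Printing Implicit Defensive.
Import Order.TTheory GRing.Theory Num.Theory.
Import numFieldNormedType.Exports.
Local Open Scope classical_set_scope.
Local Open Scope ring_scope.

(** The law of [S = \sum_k X_k a_k] is probed with a random frequency instead of
    Lebesgue measure on the dual space.  Let [T] have independent coordinates,
    each the difference of two independent uniform variables on [0, 1].  The
    characteristic function of a coordinate is [kernel u = (2 - 2 cos u) / u^2]: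
    it is nonnegative, at least [1/4] for [|u| <= 1/2], and at most
    [min (1, 4 / u^2)].

    Upper bound ([smoothing_inequality]).  On the ball of diameter [tau] around
    [x], the product of the [kernel ((S_i - x_i) / tau)] is at least [4^-d], so
    the probability of the ball is at most [4^d] times the expectation of that
    product, which by Fubini is the [T]-mean of [E cos <T / tau, S - x>], hence
    at most the [T]-mean of the modulus of the characteristic function of [S] at
    [T / tau].  By independence ([charmod2_indep_sum]) the squared modulus is a
    product over [k] of integrals of [cos (s_k z)] against the symmetrized law
    [G], where [s_k = <T, a_k> / tau].  From [x <= exp (x - 1)] and
    [lam F <= G] ([charmod2_iid_sum_le]) the modulus is at most
    [exp (- \int energy(T, z) F(dz))], where [exp (- energy(T, z))] is the
    characteristic function of [H = H_1^lam] at [z T / tau].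

    Jensen ([expR_jensen]).  With [w(z)] the integer ratio
    [1 + strict_floor (tau / (eps |z|))], adding and subtracting [d log w] and
    applying Jensen to the probability [F] bounds this exponential by
    [exp (d \int log w dF)] times the [F]-mean of
    [w(z)^-d exp (- energy(T, z))].

    Lower bound ([energy_mean_le]).  After exchanging the means, for each
    [z <> 0] the [T]-mean of [exp (- energy(T, z))] equals the [H]-mean of the
    product of the [kernel (z y_i / tau)].  Cutting the space into cubes of side
    [eps / d], each of [H]-mass at most the concentration [Q(H, eps)] because
    its diameter is at most [eps], the quadratic decay of the kernel makes the
    sum over cubes at most [(24 d w(z))^d Q(H, eps)]
    ([kernel_mean_le_cells]).  The factor [w(z)^d] cancels, which gives the
    claim with [c = (96 d)^d]. *)

(** * Integrals of bounded measurable functions *)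

Section bounded_measurable.
Context {dT : measure_display} {T : measurableType dT} {R : realType}.
Implicit Types f g : T -> R.

(** Apart from the logarithmic weight, all integrands below are bounded and all
    measures finite, so that this one predicate settles integrability and
    Fubini. *)
Definition bmfun f :=
  measurable_fun [set: T] f /\ exists M : R, forall x, `|f x| <= M.

Lemma bmfun_cst c : bmfun (fun=> c).
Proof. by split=> //; exists `|c|. Qed.

Lemma bmfunD f g : bmfun f -> bmfun g -> bmfun (fun x => f x + g x).
Proof.
move=> [mf [M fM]] [mg [N gN]]; split; first exact: measurable_funD.
by exists (M + N) => x; rewrite (le_trans (ler_normD _ _))// lerD.
Qed.

Lemma bmfunM f g : bmfun f -> bmfun g -> bmfun (fun x => f x * g x).
Proof.
move=> [mf [M fM]] [mg [N gN]]; split; first exact: measurable_funM.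
by exists (M * N) => x; rewrite normrM ler_pM.
Qed.

Lemma bmfunB f g : bmfun f -> bmfun g -> bmfun (fun x => f x - g x).
Proof.
move=> [mf [M fM]] [mg [N gN]]; split; first exact: measurable_funB.
by exists (M + N) => x; rewrite (le_trans (ler_normB _ _))// lerD.
Qed.

Lemma bmfun_sum I (r : seq I) (h : I -> T -> R) :
  (forall i, bmfun (h i)) -> bmfun (fun x => \sum_(i <- r) h i x).
Proof.
move=> bh; elim: r => [|i r IH].
  by under eq_fun do rewrite big_nil; exact: bmfun_cst.
by under eq_fun do rewrite big_cons; exact: bmfunD.
Qed.

Lemma bmfun_prod I (r : seq I) (h : I -> T -> R) :
  (forall i, bmfun (h i)) -> bmfun (fun x => \prod_(i <- r) h i x).
Proof.
move=> bh; elim: r => [|i r IH].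
  by under eq_fun do rewrite big_nil; exact: bmfun_cst.
by under eq_fun do rewrite big_cons; exact: bmfunM.
Qed.

Lemma measurable_cos : measurable_fun [set: R] cos.
Proof. exact: continuous_measurable_fun (@continuous_cos R). Qed.

Lemma measurable_sin : measurable_fun [set: R] sin.
Proof. exact: continuous_measurable_fun (@continuous_sin R). Qed.

Lemma bmfun_cos f : measurable_fun [set: T] f -> bmfun (fun x => cos (f x)).
Proof.
move=> mf; split; last by exists 1 => x; exact: cos_max.
by apply: measurableT_comp => //; exact: measurable_cos.
Qed.

Lemma bmfun_sin f : measurable_fun [set: T] f -> bmfun (fun x => sin (f x)).
Proof.
move=> mf; split; last by exists 1 => x; exact: sin_max.
by apply: measurableT_comp => //; exact: measurable_sin.
Qed.

Lemma bmfun_expRN f : measurable_fun [set: T] f -> (forall x, 0 <= f x) ->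
  bmfun (fun x => expR (- f x)).
Proof.
move=> mf f0; split.
  apply: measurableT_comp => //; exact: measurableT_comp.
by exists 1 => x; rewrite ger0_norm ?expR_ge0// -expR0 ler_expR oppr_le0.
Qed.

Lemma bmfun_indic A : measurable A -> bmfun \1_A.
Proof.
move=> mA; split; first exact: measurable_indic.
by exists 1 => x; rewrite indicE; case: (_ \in _); rewrite ?normr1 ?normr0.
Qed.

Section integral.
Variable mu : {finite_measure set T -> \bar R}.

Lemma bmfun_integrable f : bmfun f -> mu.-integrable [set: T] (EFin \o f).
Proof.
move=> [mf [M fM]]; apply: measurable_bounded_integrable => //.
  by rewrite ltey_eq fin_num_measure.
exists M; split; first exact: num_real.
by move=> x Mx t _ /=; rewrite (le_trans (fM t))// ltW.
Qed.

Lemma EFin_bmintegral f : bmfun f ->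
  (\int[mu]_x f x)%:E = (\int[mu]_x (f x)%:E)%E.
Proof.
by move=> bf; rewrite /Rintegral fineK//; apply: integrable_fin_num => //;
  exact: bmfun_integrable.
Qed.

Lemma bmintegralD f g : bmfun f -> bmfun g ->
  \int[mu]_x (f x + g x) = \int[mu]_x f x + \int[mu]_x g x.
Proof. by move=> bf bg; rewrite RintegralD//; exact: bmfun_integrable. Qed.

Lemma bmintegralB f g : bmfun f -> bmfun g ->
  \int[mu]_x (f x - g x) = \int[mu]_x f x - \int[mu]_x g x.
Proof. by move=> bf bg; rewrite RintegralB//; exact: bmfun_integrable. Qed.

Lemma bmintegralZl f c : bmfun f ->
  \int[mu]_x (c * f x) = c * \int[mu]_x f x.
Proof. by move=> bf; rewrite RintegralZl//; exact: bmfun_integrable. Qed.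

Lemma bmintegralZr f c : bmfun f ->
  \int[mu]_x (f x * c) = \int[mu]_x f x * c.
Proof. by move=> bf; rewrite RintegralZr//; exact: bmfun_integrable. Qed.

Lemma bmintegral_sum I (r : seq I) (h : I -> T -> R) :
  (forall i, bmfun (h i)) ->
  \int[mu]_x (\sum_(i <- r) h i x) = \sum_(i <- r) \int[mu]_x h i x.
Proof.
move=> bh; elim: r => [|i r IH].
  rewrite big_nil; under eq_Rintegral do rewrite big_nil.
  by rewrite Rintegral_cst// mul0r.
rewrite big_cons -IH -bmintegralD//; last exact: bmfun_sum.
by apply: eq_Rintegral => x _; rewrite big_cons.
Qed.

Lemma le_bmintegral f g : bmfun f -> bmfun g -> (forall x, f x <= g x) ->
  \int[mu]_x f x <= \int[mu]_x g x.
Proof.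
by move=> bf bg fg; apply: le_Rintegral => //; exact: bmfun_integrable.
Qed.

Lemma le_norm_bmintegral f : bmfun f ->
  `|\int[mu]_x f x| <= \int[mu]_x `|f x|.
Proof.
by move=> bf; apply: le_normr_Rintegral => //; exact: bmfun_integrable.
Qed.

Lemma bmintegral_indic A : measurable A -> (\int[mu]_x \1_A x)%:E = mu A.
Proof.
by move=> mA; rewrite EFin_bmintegral ?integral_indic ?setIT//;
  exact: bmfun_indic.
Qed.

End integral.

Lemma prob_bmintegral_cst (mu : probability T R) c : \int[mu]_(_ in setT) c = c.
Proof. by rewrite Rintegral_cst// [X in fine X](probability_setT mu) mulr1. Qed.

End bounded_measurable.

Lemma bmfun_comp d1 d2 (T1 : measurableType d1) (T2 : measurableType d2)
    (R : realType) (f : T2 -> R) (h : T1 -> T2) :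
  measurable_fun [set: T1] h -> bmfun f -> bmfun (f \o h).
Proof.
move=> mh [mf [M fM]]; split; first exact: measurableT_comp.
by exists M => x; exact: fM.
Qed.

Lemma bmintegral_distribution d1 d2 (T1 : measurableType d1)
    (T2 : measurableType d2) (R : realType) (P : probability T1 R)
    (h : {mfun T1 >-> T2}) (f : T2 -> R) :
  bmfun f -> \int[distribution P h]_y f y = \int[P]_x f (h x).
Proof.
move=> bf; rewrite /Rintegral integral_distribution//.
- apply: measurableT_comp => //; exact: bf.1.
- exact: (bmfun_integrable P (bmfun_comp (measurable_funPT h) bf)).
Qed.

Section bmfubini.
Context d1 d2 (T1 : measurableType d1) (T2 : measurableType d2) (R : realType).
Variables (m1 : probability T1 R) (m2 : probability T2 R).
Variable f : T1 * T2 -> R.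
Hypothesis bf : bmfun f.

Let m12 : probability (T1 * T2)%type R := (m1 \x m2)%E.

Let if12 : (m1 \x m2)%E.-integrable [set: T1 * T2] (EFin \o f).
Proof. exact: (bmfun_integrable m12 bf). Qed.

Lemma bmfun_pairl x : bmfun (fun y => f (x, y)).
Proof. by have := bmfun_comp (measurable_pair1 x) bf. Qed.

Lemma bmfun_pairr y : bmfun (fun x => f (x, y)).
Proof. by have := bmfun_comp (measurable_pair2 y) bf. Qed.

Lemma bmfun_fubini_F : bmfun (fun x => \int[m2]_y f (x, y)).
Proof.
split.
  apply: (measurableT_comp (f := fine)); first exact: fine_measurable.
  exact: (measurable_fubini_F if12).
have [_ [M fM]] := bf; exists M => x.
rewrite (le_trans (le_norm_bmintegral _ (bmfun_pairl x)))//.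
rewrite -[leRHS](prob_bmintegral_cst m2 M) le_bmintegral//.
- split; first exact: measurableT_comp (bmfun_pairl x).1.
  by exists M => ?; rewrite normr_id.
- exact: bmfun_cst.
Qed.

Lemma bmintegral_prod1 :
  \int[(m1 \x m2)%E]_z f z = \int[m1]_x \int[m2]_y f (x, y).
Proof.
rewrite {1 2}/Rintegral -(integral12_prod_meas1 if12).
congr fine; apply: eq_integral => x _.
by rewrite EFin_bmintegral//; exact: bmfun_pairl.
Qed.

Lemma bmintegral_prod2 :
  \int[(m1 \x m2)%E]_z f z = \int[m2]_y \int[m1]_x f (x, y).
Proof.
rewrite {1 2}/Rintegral -(integral21_prod_meas1 if12).
congr fine; apply: eq_integral => x _.
by rewrite EFin_bmintegral//; exact: bmfun_pairr.
Qed.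

Lemma bmfubini :
  \int[m1]_x \int[m2]_y f (x, y) = \int[m2]_y \int[m1]_x f (x, y).
Proof. by rewrite -bmintegral_prod1 bmintegral_prod2. Qed.

End bmfubini.

(** * The random frequency and its kernel *)

Section symmetrization.
Context d1 d2 (T1 : measurableType d1) (T2 : measurableType d2) (R : realType).
Variables (P1 : probability T1 R) (P2 : probability T2 R).
Variables (f : T1 -> R) (g : T2 -> R).
Hypotheses (mf : measurable_fun [set: T1] f) (mg : measurable_fun [set: T2] g).

Let mfg : measurable_fun [set: T1 * T2] (fun z => f z.1 + g z.2).
Proof.
by apply: measurable_funD; apply: measurableT_comp.
Qed.

Lemma integral_cosD_prod :
  \int[(P1 \x P2)%E]_z cos (f z.1 + g z.2) =
  \int[P1]_x cos (f x) * \int[P2]_y cos (g y) -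
  \int[P1]_x sin (f x) * \int[P2]_y sin (g y).
Proof.
rewrite bmintegral_prod1; last exact: bmfun_cos.
have bcf := bmfun_cos mf; have bsf := bmfun_sin mf.
have bcg := bmfun_cos mg; have bsg := bmfun_sin mg.
under eq_Rintegral => x _ /=.
  under eq_Rintegral do rewrite cosD.
  rewrite bmintegralB; [|exact: bmfunM (bmfun_cst _) bcg|
    exact: bmfunM (bmfun_cst _) bsg].
  rewrite !bmintegralZl//.
  over.
rewrite bmintegralB ?bmintegralZr//.
- exact: bmfunM bcf (bmfun_cst _).
- exact: bmfunM bsf (bmfun_cst _).
Qed.

Lemma integral_sinD_prod :
  \int[(P1 \x P2)%E]_z sin (f z.1 + g z.2) =
  \int[P1]_x sin (f x) * \int[P2]_y cos (g y) +
  \int[P1]_x cos (f x) * \int[P2]_y sin (g y).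
Proof.
rewrite bmintegral_prod1; last exact: bmfun_sin.
have bcf := bmfun_cos mf; have bsf := bmfun_sin mf.
have bcg := bmfun_cos mg; have bsg := bmfun_sin mg.
under eq_Rintegral => x _ /=.
  under eq_Rintegral do rewrite sinD.
  rewrite bmintegralD; [|exact: bmfunM (bmfun_cst _) bcg|
    exact: bmfunM (bmfun_cst _) bsg].
  rewrite !bmintegralZl//.
  over.
rewrite bmintegralD ?bmintegralZr//.
- exact: bmfunM bsf (bmfun_cst _).
- exact: bmfunM bcf (bmfun_cst _).
Qed.

End symmetrization.

Section char_modulus.
Context d (T : measurableType d) (R : realType) (P : probability T R).
Implicit Type f : T -> R.

(** The squared modulus of [E exp(i f)]. *)
Definition charmod2 f : R :=
  (\int[P]_x cos (f x)) ^+ 2 + (\int[P]_x sin (f x)) ^+ 2.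

Lemma charmod2_ge0 f : 0 <= charmod2 f.
Proof. by rewrite addr_ge0// sqr_ge0. Qed.

Let int_sinN f : measurable_fun [set: T] f ->
  \int[P]_x sin (- f x) = - \int[P]_x sin (f x).
Proof.
move=> mf; rewrite -mulN1r -bmintegralZl; last exact: bmfun_sin.
by apply: eq_Rintegral => x _; rewrite sinN mulN1r.
Qed.

Lemma integral_cos_symm f : measurable_fun [set: T] f ->
  \int[(P \x P)%E]_z cos (f z.1 - f z.2) = charmod2 f.
Proof.
move=> mf; rewrite (integral_cosD_prod P P mf (measurable_funN mf)) int_sinN//.
under [X in _ * X - _]eq_Rintegral do rewrite cosN.
by rewrite /charmod2 mulrN opprK -!expr2.
Qed.

(** [f(z.1) - f(z.2)] is symmetric, so its characteristic function is real. *)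
Lemma integral_sin_symm f : measurable_fun [set: T] f ->
  \int[(P \x P)%E]_z sin (f z.1 - f z.2) = 0.
Proof.
move=> mf; rewrite (integral_sinD_prod P P mf (measurable_funN mf)) int_sinN//.
under [X in _ * X + _]eq_Rintegral do rewrite cosN.
by rewrite mulrN mulrC subrr.
Qed.

Lemma charmod2_le1 f : measurable_fun [set: T] f -> charmod2 f <= 1.
Proof.
move=> mf; rewrite -integral_cos_symm//.
pose PP : probability (T * T)%type R := (P \x P)%E.
rewrite -[leRHS](prob_bmintegral_cst PP) /PP; apply: (@le_bmintegral _ _ _ PP).
- by apply: bmfun_cos; apply: measurable_funB; apply: measurableT_comp.
- exact: bmfun_cst.
- by move=> z; exact: cos_le1.
Qed.

End char_modulus.

Section uniform_kernel.
Context {R : realType}.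
Implicit Types u x : R.

Definition unif01 : probability (measurableTypeR R) R :=
  uniform_prob (@ltr01 R).

(** The integral formula for the uniform law needs a nonnegative integrand, so
    the fundamental theorem is applied to [M + f], with [M] a bound of [|f|]. *)
Lemma unif01_FTC (f F : R -> R) : continuous f ->
  bmfun (f : measurableTypeR R -> R) ->
  (forall x, is_derive x 1 F (f x)) -> \int[unif01]_x f x = F 1 - F 0.
Proof.
move=> cf bf dF; have [mf [M fM]] := bf.
have bMf : bmfun (fun x : measurableTypeR R => M + f x).
  exact: bmfunD (bmfun_cst M) bf.
suff : \int[unif01]_x (M + f x) = M + (F 1 - F 0).
  rewrite bmintegralD ?prob_bmintegral_cst//; last exact: bmfun_cst.
  exact: addrI.
apply: EFin_inj; rewrite EFin_bmintegral// integral_uniform//; first last.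
- by move=> x; rewrite lee_fin -lerBlDl sub0r (le_trans _ (lerNnormlW (fM x))).
- by apply/measurable_EFinP; exact: bMf.1.
have dG x : is_derive x 1 (fun x : R => M * x + F x) (M + f x).
  have dM : is_derive x 1 (fun x : R => M * x) M.
    by apply: is_derive_eq; rewrite /GRing.scale/= mulr1.
  exact: is_deriveD.
have cG : continuous (fun x : R => M * x + F x).
  move=> x; apply: differentiable_continuous; apply/derivable1_diffP.
  exact: ex_derive.
rewrite (@continuous_FTC2 _ _ (fun x : R => M * x + F x))//.
- by rewrite subr0 invr1 mul1e -EFinD mulr0 mulr1; congr EFin; ring.
- apply: continuous_subspaceT => x; apply: continuousD; last exact: cf.
  exact: cst_continuous.
- split.
  + by move=> x _; exact: ex_derive.
  + by apply: cvg_at_right_filter; exact: cG.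
  + by apply: cvg_at_left_filter; exact: cG.
- by move=> x _; rewrite derive1E; exact: derive_val.
Qed.

Let is_deriveZ u x : is_derive x 1 (fun x : R => u * x) u.
Proof. by apply: is_derive_eq; rewrite /GRing.scale/= mulr1. Qed.

Let mZ u : measurable_fun [set: measurableTypeR R] (fun x => u * x).
Proof. exact: mulrl_measurable. Qed.

Lemma unif01_cos u : u * \int[unif01]_x cos (u * x) = sin u.
Proof.
rewrite -bmintegralZl; last exact: bmfun_cos.
have dF x : is_derive x 1 (fun x => sin (u * x)) (u * cos (u * x)).
  have := is_derive1_comp (is_derive_sin (u * x)) (is_deriveZ u x).
  by rewrite mulrC.
rewrite (@unif01_FTC (fun x => u * cos (u * x)) (fun x => sin (u * x)) _ _ dF).
- by rewrite mulr1 mulr0 sin0 subr0.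
- move=> x; apply: continuousM; first exact: cst_continuous.
  apply: (@continuous_comp _ _ _ (fun x => u * x)); last exact: continuous_cos.
  exact: mulrl_continuous.
- exact: bmfunM (bmfun_cst _) (bmfun_cos (mZ u)).
Qed.

Lemma unif01_sin u : u * \int[unif01]_x sin (u * x) = 1 - cos u.
Proof.
rewrite -bmintegralZl; last exact: bmfun_sin.
have dF x : is_derive x 1 (fun x => - cos (u * x)) (u * sin (u * x)).
  have := is_deriveN (is_derive1_comp (is_derive_cos (u * x)) (is_deriveZ u x)).
  by rewrite mulNr opprK mulrC.
rewrite (@unif01_FTC (fun x => u * sin (u * x))
  (fun x => - cos (u * x)) _ _ dF).
- by rewrite mulr1 mulr0 cos0 opprK addrC.
- move=> x; apply: continuousM; first exact: cst_continuous.
  apply: (@continuous_comp _ _ _ (fun x => u * x)); last exact: continuous_sin.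
  exact: mulrl_continuous.
- exact: bmfunM (bmfun_cst _) (bmfun_sin (mZ u)).
Qed.

(** The characteristic function [(2 - 2 cos u) / u^2] of the difference of
    two independent uniform variables on [0, 1]. *)
Definition kernel u : R := charmod2 unif01 (fun x => u * x).

Lemma kernel_ge0 u : 0 <= kernel u.
Proof. exact: charmod2_ge0. Qed.

Lemma kernel_le1 u : kernel u <= 1.
Proof. exact: charmod2_le1. Qed.

(** Multiplying by [u] turns the two integrals into [sin u] and [1 - cos u]. *)
Lemma kernel_decay u : u ^+ 2 * kernel u <= 4.
Proof.
rewrite /kernel /charmod2 mulrDr -!exprMn unif01_cos unif01_sin.
have := cos2Dsin2 u; have := cos_geN1 u; nra.
Qed.

Lemma cos_ge_half u : `|u| <= 2^-1 -> 2^-1 <= cos u.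
Proof.
rewrite -cos_norm; move: (normr_ge0 u); set x := `|u| => x0 x2.
have [|c _] := @MVT_segment R cos (fun x => - sin x) 0 x x0
    (fun y _ => is_derive_cos y).
  by apply: continuous_subspaceT => y; exact: continuous_cos.
by rewrite cos0; have := sin_le1 c; nra.
Qed.

(** By the mean value theorem, [sin u / u] is a value of [cos] between [0] and
    [u]. *)
Lemma kernel_ge_quarter u : `|u| <= 2^-1 -> 4^-1 <= kernel u.
Proof.
move=> u2; have : 2^-1 <= \int[unif01]_x cos (u * x).
  have -> : \int[unif01]_x cos (u * x) = \int[unif01]_x cos (`|u| * x).
    apply: eq_Rintegral => x _.
    by rewrite -[LHS]cos_norm -[RHS]cos_norm !normrM normr_id.
  have [->|u0] := eqVneq `|u| 0.
    under eq_Rintegral do rewrite mul0r cos0.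
    by rewrite prob_bmintegral_cst invf_le1 ?ler1n.
  have {}u0 : 0 < `|u| by rewrite lt_neqAle eq_sym u0 normr_ge0.
  have [|c c01] := @MVT_segment R sin cos 0 `|u| (normr_ge0 u)
      (fun y _ => is_derive_sin y).
    by apply: continuous_subspaceT => y; exact: continuous_sin.
  rewrite sin0 !subr0 -unif01_cos mulrC => /(mulIf (lt0r_neq0 u0)) ->.
  apply: cos_ge_half; move: c01; rewrite in_itv/= => /andP[c0 cu].
  by rewrite ger0_norm// (le_trans cu).
rewrite /kernel /charmod2; set C := \int[_]_x _; set S := \int[_]_x _.
nra.
Qed.

Lemma bmfun_kernel : bmfun kernel.
Proof.
pose UU : probability (measurableTypeR R * measurableTypeR R)%type R :=
  (unif01 \x unif01)%E.
have bf : bmfun (fun p : R * (measurableTypeR R * measurableTypeR R) =>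
    cos (p.1 * p.2.1 - p.1 * p.2.2)).
  apply: bmfun_cos; apply: measurable_funB; apply: measurable_funM => //.
    exact: measurableT_comp measurable_fst measurable_snd.
  exact: measurableT_comp measurable_snd measurable_snd.
have := bmfun_fubini_F (@dirac _ R 0 R) UU bf.
rewrite (_ : (fun u => _) = kernel)//.
by apply/funext => u; exact: integral_cos_symm (mZ u).
Qed.

End uniform_kernel.

(** The vector is built one coordinate at a time on product spaces.  The
    vanishing of the sine integral is carried along because the addition formula
    for the cosine calls for it. *)
Lemma exists_kernel_frequency (R : realType) (d : nat) :
  exists (dsp : measure_display) (Om : measurableType dsp)
    (Q : probability Om R) (T : 'I_d -> Om -> R),
    (forall i, measurable_fun [set: Om] (T i)) /\
    forall u : 'I_d -> R,
      \int[Q]_w cos (\sum_(i < d) u i * T i w) = \prod_(i < d) kernel (u i) /\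
      \int[Q]_w sin (\sum_(i < d) u i * T i w) = 0.
Proof.
elim: d => [|d [dsp [Om [Q [T [mT TE]]]]]].
  exists _, unit, (@dirac _ unit tt R), (fun _ _ => 0); split=> // u.
  rewrite big_ord0; split.
    under eq_Rintegral do rewrite big_ord0 cos0.
    exact: prob_bmintegral_cst.
  under eq_Rintegral do rewrite big_ord0 sin0.
  exact: prob_bmintegral_cst.
pose UU : probability (measurableTypeR R * measurableTypeR R)%type R :=
  (unif01 \x unif01)%E.
pose T' (i : 'I_d.+1) (w : (measurableTypeR R * measurableTypeR R) * Om) : R :=
  if unlift ord0 i is Some j then T j w.2 else w.1.1 - w.1.2.
pose UUQ : probability ((measurableTypeR R * measurableTypeR R) * Om)%type R :=
  (UU \x Q)%E.
exists _, _, UUQ, T'.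
have mD : measurable_fun
    [set: measurableTypeR R * measurableTypeR R] (fun z => z.1 - z.2 : R).
  by apply: measurable_funB; [exact: measurable_fst|exact: measurable_snd].
split=> [i|u].
  rewrite /T'; case: (unlift ord0 i) => [j|]; last exact: measurableT_comp mD _.
  exact: measurableT_comp (mT j) _.
pose f (z : measurableTypeR R * measurableTypeR R) : R :=
  u ord0 * z.1 - u ord0 * z.2.
pose g (w : Om) : R := \sum_(i < d) u (lift ord0 i) * T i w.
have sumE w : \sum_(i < d.+1) u i * T' i w = f w.1 + g w.2.
  rewrite big_ord_recl /T' unlift_none mulrBr; congr (_ + _).
  by apply: eq_bigr => i _; rewrite liftK.
have mf : measurable_fun [set: measurableTypeR R * measurableTypeR R] f.
  by apply: measurable_funB; exact: measurable_funM.
have mg : measurable_fun [set: Om] g.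
  by apply: measurable_sum => i; exact: measurable_funM.
have mu0 : measurable_fun [set: measurableTypeR R] (fun x => u ord0 * x).
  exact: mulrl_measurable.
have [gcos gsin] := TE (fun i => u (lift ord0 i)).
have fcos : \int[UU]_z cos (f z) = kernel (u ord0).
  exact: integral_cos_symm mu0.
have fsin : \int[UU]_z sin (f z) = 0.
  exact: integral_sin_symm mu0.
split.
  under eq_Rintegral do rewrite sumE.
  by rewrite (integral_cosD_prod UU Q mf mg) fcos gcos fsin mul0r
     subr0 big_ord_recl.
under eq_Rintegral do rewrite sumE.
by rewrite (integral_sinD_prod UU Q mf mg) fsin gsin mul0r mulr0 addr0.
Qed.

(** * Sums of independent variables *)

Section joint_law.
Context d (Omega : measurableType d) (R : realType) (P : probability Omega R).
Variables Y Z : {RV P >-> R}.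
Hypothesis YZ_indep : forall A C : set R, measurable A -> measurable C ->
  P (Y @^-1` A `&` Z @^-1` C) = (P (Y @^-1` A) * P (Z @^-1` C))%E.

Let mYZ : measurable_fun [set: Omega] (fun w => (Y w, Z w)).
Proof. exact/measurable_fun_pairP. Qed.

Let YZ_mixin := isMeasurableFun.Build _ _ _ _ _ mYZ.
Let YZ : {mfun Omega >-> (R * R)%type} :=
  HB.pack (fun w => (Y w, Z w)) YZ_mixin.

(** Two finite measures on the plane agreeing on rectangles are equal. *)
Lemma indep_joint_law (E : set (R * R)) : measurable E ->
  (distribution P Y \x distribution P Z)%E E = distribution P YZ E.
Proof.
apply: product_measure_unique => A C mA mC.
by rewrite /distribution/= /pushforward/= -YZ_indep.
Qed.

Lemma bmintegral_indep (f : R * R -> R) : bmfun f ->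
  \int[P]_w f (Y w, Z w) = \int[(distribution P Y \x distribution P Z)%E]_z f z.
Proof.
move=> bf; rewrite -(bmintegral_distribution P YZ bf).
congr fine; apply: eq_measure_integral => E mE _.
exact/esym/indep_joint_law.
Qed.

(** Extending independence from rectangles to all planar Borel sets while
    keeping a third event [D] in the intersection. *)
Lemma indep_joint_event (D : set Omega) : measurable D ->
  (forall A C : set R, measurable A -> measurable C ->
    P (Y @^-1` A `&` Z @^-1` C `&` D) =
    (P (Y @^-1` A) * P (Z @^-1` C) * P D)%E) ->
  forall E : set (R * R), measurable E ->
    P ((fun w => (Y w, Z w)) @^-1` E `&` D) =
    (P ((fun w => (Y w, Z w)) @^-1` E) * P D)%E.
Proof.
move=> mD YZD E mE.
have c0 : 0 <= fine (P D) by rewrite fine_ge0.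
have cE : P D = (fine (P D))%:E by rewrite fineK// fin_num_measure.
pose c : {nonneg R} := NngNum c0.
pose PD : {measure set Omega -> \bar R} := mrestr P mD.
pose m1 : {measure set (R * R) -> \bar R} := pushforward PD YZ.
pose m2 : {measure set (R * R) -> \bar R} := mscale c (distribution P YZ).
pose nu : {finite_measure set R -> \bar R} := mscale c (distribution P Z).
have -> : P ((fun w => (Y w, Z w)) @^-1` E `&` D) =
    (distribution P Y \x nu)%E E.
  apply/esym; rewrite -[RHS]/(m1 mYZ E).
  apply: product_measure_unique => // A C mA mC.
  rewrite /m1/= /pushforward/= /PD/= /mrestr/=.
  rewrite -[LHS]/(P (Y @^-1` A `&` Z @^-1` C `&` D)) YZD//.
  by rewrite /nu/= /mscale/= -cE muleA muleAC.
have -> : (P ((fun w => (Y w, Z w)) @^-1` E) * P D)%E = m2 E.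
  by rewrite /m2/= /mscale/= -cE muleC.
apply: product_measure_unique => // A C mA mC.
rewrite /m2 /nu /= /mscale/=.
rewrite -[X in (_ * X)%E = _]/(P (Y @^-1` A `&` Z @^-1` C)) YZ_indep//.
by rewrite muleCA.
Qed.

End joint_law.

Section independent_sum.
Context d (Omega : measurableType d) (R : realType) (P : probability Omega R).
Context (I : finType) (X : I -> {RV P >-> R}) (w : I -> R).
Hypothesis X_indep : mutually_independent X.

Let psum (s : seq I) (o : Omega) : R := \sum_(k <- s) w k * X k o.

Let mpsum s : measurable_fun [set: Omega] (psum s).
Proof. by apply: measurable_sum => k; exact: measurable_funM. Qed.

Let psumRV s : {RV P >-> R} :=
  HB.pack (psum s) (isMeasurableFun.Build _ _ _ _ _ (mpsum s)).

Let event (J : {set I}) (B : I -> set R) : set Omega :=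
  \bigcap_(i in [set` J]) (X i @^-1` B i).

Let measurable_event J B : (forall i, measurable (B i)) ->
  measurable (event J B).
Proof.
move=> mB; apply: fin_bigcap_measurable => [|i _]; first exact: finite_finset.
by rewrite -[_ @^-1` _]setTI; exact: measurable_funPT.
Qed.

Let P_eventU k (J : {set I}) B C : k \notin J ->
  (forall i, measurable (B i)) -> measurable C ->
  exists2 B', (forall i, measurable (B' i)) &
    event (k |: J) B' = X k @^-1` C `&` event J B /\
    P (event (k |: J) B') = (P (X k @^-1` C) * P (event J B))%E.
Proof.
move=> kJ mB mC; exists (fun i => if i == k then C else B i).
  by move=> i; case: ifP.
split.
  apply/seteqP; split=> o /=.
    move=> h; split; first by have := h k; rewrite /= eqxx setU11; exact.
    move=> i /= iJ; have := h i; rewrite /= inE iJ orbT => /(_ isT).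
    by case: eqP => // ik; rewrite -ik iJ in kJ.
  move=> [hk hJ] i /=; rewrite !inE; case: eqP => [->//|_ /=]; exact: hJ.
rewrite X_indep; last by move=> i; case: ifP.
rewrite big_setU1//= eqxx X_indep//; congr (_ * _)%E.
by apply: eq_bigr => i iJ; case: eqP => // ik; rewrite -ik iJ in kJ.
Qed.

(** Partial sums are handled one term at a time: the event [event J B] on the
    variables that have not been summed yet is what lets the induction use
    mutual, and not only pairwise, independence. *)
Let psum_indep_event s : uniq s -> forall (J : {set I}) B,
  {in s, forall k, k \notin J} -> (forall i, measurable (B i)) ->
  forall A, measurable A ->
    P (psum s @^-1` A `&` event J B) = (P (psum s @^-1` A) * P (event J B))%E.
Proof.
elim: s => [_ J B _ mB A mA|k s IH /= /andP[ks us] J B sJ mB A mA].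
  have [A0|A0] := pselect (A 0).
    have -> : psum [::] @^-1` A = setT.
      by apply/seteqP; split=> // o _ /=; rewrite /psum big_nil.
    by rewrite setTI probability_setT mul1e.
  have -> : psum [::] @^-1` A = set0.
    by apply/seteqP; split=> // o /=; rewrite /psum big_nil.
  by rewrite set0I measure0 mul0e.
have kJ : k \notin J by apply: sJ; rewrite mem_head.
have rect (J' : {set I}) (B' : I -> set R) (A' C : set R) :
    {in k :: s, forall i, i \notin J'} ->
    (forall i, measurable (B' i)) -> measurable A' -> measurable C ->
    P (psum s @^-1` A' `&` X k @^-1` C `&` event J' B') =
    (P (psum s @^-1` A') * P (X k @^-1` C) * P (event J' B'))%E.
  move=> sJ' mB' mA' mC.
  have kJ' : k \notin J' by apply: sJ'; rewrite mem_head.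
  have [B'' mB'' [evE PE]] := P_eventU kJ' mB' mC.
  rewrite -setIA -evE IH//; first by rewrite PE muleA.
  move=> i si; rewrite !inE negb_or sJ' ?inE ?si ?orbT// andbT.
  by apply: contraNneq ks => <-.
have YZ (A' C : set R) : measurable A' -> measurable C ->
    P (psumRV s @^-1` A' `&` X k @^-1` C) =
    (P (psumRV s @^-1` A') * P (X k @^-1` C))%E.
  move=> mA' mC; have := rect finset.set0 (fun=> setT) A' C.
  have -> : event finset.set0 (fun=> setT) = setT.
    by apply/seteqP; split=> // o _ i /=.
  rewrite setIT probability_setT mule1; apply=> //.
  by move=> i _; rewrite inE.
pose E : set (R * R) := (fun z => w k * z.2 + z.1) @^-1` A.
have mE : measurable E.
  rewrite -[E]setTI; apply: (_ : measurable_fun setT _) => //.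
  apply: measurable_funD; last exact: measurable_fst.
  by apply: measurable_funM => //; exact: measurable_snd.
have -> : psum (k :: s) @^-1` A = (fun o => (psumRV s o, X k o)) @^-1` E.
  by apply/seteqP; split=> o /=; rewrite /E/= /psum big_cons.
apply: (indep_joint_event YZ) => //; first exact: measurable_event.
by move=> A' C mA' mC; exact: rect.
Qed.

(** The addition formulas make [charmod2] multiplicative on independent pairs:
    [(ac - bd)^2 + (bc + ad)^2 = (a^2 + b^2) (c^2 + d^2)]. *)
Lemma charmod2_indep_sum :
  charmod2 P (fun o => \sum_k w k * X k o) =
  \prod_k charmod2 P (fun o => w k * X k o).
Proof.
rewrite -/(psum (index_enum I)).
have : uniq (index_enum I) by exact: index_enum_uniq.
elim: (index_enum I) => [_|k s IH /= /andP[ks us]].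
  rewrite big_nil /charmod2.
  under eq_Rintegral do rewrite /psum big_nil cos0.
  under [X in _ + X ^+ 2]eq_Rintegral do rewrite /psum big_nil sin0.
  by rewrite !prob_bmintegral_cst expr0n addr0 expr1n.
rewrite big_cons -IH//.
have YZ (A C : set R) : measurable A -> measurable C ->
    P (psumRV s @^-1` A `&` X k @^-1` C) =
    (P (psumRV s @^-1` A) * P (X k @^-1` C))%E.
  move=> mA mC.
  have := psum_indep_event us (J := [set k]%SET) (B := fun=> C) _ _ mA.
  have -> : event [set k]%SET (fun=> C) = X k @^-1` C.
    apply/seteqP; split=> o /=; first by move=> /(_ k); apply; rewrite /= inE.
    by move=> h i /=; rewrite inE => /eqP ->.
  apply=> // i si; rewrite inE; apply: contraNneq ks => <-//.
have mwk : measurable_fun [set: R] (fun y => w k * y).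
  exact: mulrl_measurable.
have mid : measurable_fun [set: R] (@idfun R) by exact: measurable_id.
have mS : measurable_fun [set: R * R] (fun z => w k * z.2 + z.1).
  apply: measurable_funD; last exact: measurable_fst.
  by apply: measurable_funM => //; exact: measurable_snd.
have law (Z : {RV P >-> R}) (f : R -> R) : bmfun f ->
    \int[distribution P Z]_y f y = \int[P]_o f (Z o).
  by move=> bf; rewrite bmintegral_distribution.
have cosE : \int[P]_o cos (psum (k :: s) o) =
    \int[P]_o cos (psum s o) * \int[P]_o cos (w k * X k o) -
    \int[P]_o sin (psum s o) * \int[P]_o sin (w k * X k o).
  under eq_Rintegral do rewrite /psum big_cons.
  rewrite (bmintegral_indep YZ (bmfun_cos mS)).
  under eq_Rintegral do rewrite addrC.
  rewrite (integral_cosD_prod _ _ mid mwk) !law//;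
    exact: bmfun_cos || exact: bmfun_sin.
have sinE : \int[P]_o sin (psum (k :: s) o) =
    \int[P]_o sin (psum s o) * \int[P]_o cos (w k * X k o) +
    \int[P]_o cos (psum s o) * \int[P]_o sin (w k * X k o).
  under eq_Rintegral do rewrite /psum big_cons.
  rewrite (bmintegral_indep YZ (bmfun_sin mS)).
  under eq_Rintegral do rewrite addrC.
  rewrite (integral_sinD_prod _ _ mid mwk) !law//;
    exact: bmfun_cos || exact: bmfun_sin.
by rewrite /charmod2 cosE sinE; ring.
Qed.

End independent_sum.

(** * Minorants of the symmetrized law *)

Section symmetrized_minorant.
Context d (Omega : measurableType d) (R : realType) (P : probability Omega R).
Implicit Types (X : {RV P >-> R}) (F : probability R R).

Lemma charmod2_distribution X (f : R -> R) : measurable_fun [set: R] f ->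
  charmod2 (distribution P X) f = charmod2 P (f \o X).
Proof.
move=> mf; rewrite /charmod2; congr (_ ^+ 2 + _ ^+ 2).
  exact/bmintegral_distribution/bmfun_cos.
exact/bmintegral_distribution/bmfun_sin.
Qed.

Lemma bmfun_1Bcos s : bmfun (fun z : R => 1 - cos (s * z)).
Proof.
apply: bmfunB; first exact: bmfun_cst.
by apply: bmfun_cos; exact: mulrl_measurable.
Qed.

(** [1 - charmod2] is the integral of [1 - cos (s z)] against the symmetrized
    law; the integrand is nonnegative, so a smaller measure integrates it to
    less. *)
Lemma minorant_charmod2 X F (lam : R) : 0 <= lam ->
  (forall B, measurable B -> lam%:E * F B <= symmetrized_law X B)%E ->
  forall s, lam * \int[F]_z (1 - cos (s * z)) <=
    1 - charmod2 P (fun o => s * X o).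
Proof.
move=> lam0 FG s.
have b1 := bmfun_1Bcos s.
have pos (z : R) : (0 <= (1 - cos (s * z))%:E)%E.
  by rewrite lee_fin subr_ge0 cos_le1.
pose PX := distribution P X.
pose PXX : probability (R * R)%type R := (PX \x PX)%E.
have mD : measurable_fun [set: R * R] (fun z => z.1 - z.2 : R).
  by apply: measurable_funB; [exact: measurable_fst|exact: measurable_snd].
pose D : {mfun (R * R)%type >-> R} :=
  HB.pack (fun z : R * R => z.1 - z.2 : R) (isMeasurableFun.Build _ _ _ _ _ mD).
have ms : measurable_fun [set: R] (fun z : R => s * z).
  exact: mulrl_measurable.
have -> : 1 - charmod2 P (fun o => s * X o) =
    \int[distribution PXX D]_z (1 - cos (s * z)).
  rewrite bmintegral_distribution//.
  rewrite bmintegralB ?prob_bmintegral_cst//; first last.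
  - by apply: bmfun_cos; exact: (measurableT_comp ms mD).
  - exact: bmfun_cst.
  rewrite -(charmod2_distribution X ms) -integral_cos_symm//.
  by congr (_ - _); apply: eq_Rintegral => z _ /=; rewrite mulrBr.
rewrite -lee_fin EFinM !EFin_bmintegral//.
pose c : {nonneg R} := NngNum lam0.
have -> : lam = c%:num by [].
rewrite -ge0_integral_mscale//; last by apply/measurable_EFinP; exact: b1.1.
apply: ge0_le_measure_integral => //.
by apply/measurable_EFinP; exact: b1.1.
Qed.

Lemma iid_some_indep n (X : {RV P >-> R}) (Xs : 'I_n -> {RV P >-> R}) :
  mutually_independent (oapp Xs X) -> mutually_independent Xs.
Proof.
move=> ind J B mB.
have := ind (Some @: J) (oapp B setT).
have -> : \bigcap_(i in [set` Some @: J]) (oapp Xs X i @^-1` oapp B setT i) =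
    \bigcap_(i in [set` J]) (Xs i @^-1` B i).
  apply/seteqP; split=> o /= h.
    by move=> i /= iJ; apply: (h (Some i)); rewrite /= imset_f.
  by move=> [i|] /= /imsetP[j jJ]// [->]; exact: h.
rewrite big_imset/=; last by move=> i j _ _ [].
by apply; case=> [i|] /=; [exact: mB|exact: measurableT].
Qed.

(** A product of factors [x] in [0, 1] is at most the product of the
    [exp (x - 1)]. *)
Lemma charmod2_iid_sum_le n X (Xs : 'I_n -> {RV P >-> R}) F (lam : R)
    (w : 'I_n -> R) :
  iid (oapp Xs X) -> 0 <= lam ->
  (forall B, measurable B -> lam%:E * F B <= symmetrized_law X B)%E ->
  charmod2 P (fun o => \sum_(k < n) w k * Xs k o) <=
  expR (- (lam * \int[F]_z \sum_(k < n) (1 - cos (w k * z)))).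
Proof.
move=> [ind idd] lam0 FG.
rewrite (charmod2_indep_sum _ (iid_some_indep ind)).
rewrite bmintegral_sum; last by move=> k; exact: bmfun_1Bcos.
rewrite mulr_sumr -sumrN expR_sum.
apply: ler_prod => k _; rewrite charmod2_ge0/=.
have mw : measurable_fun [set: R] (fun z : R => w k * z).
  exact: mulrl_measurable.
have -> : charmod2 P (fun o => w k * Xs k o) = charmod2 P (fun o => w k * X o).
  rewrite -(charmod2_distribution (Xs k) mw) -(charmod2_distribution X mw).
  rewrite /charmod2; congr (_ ^+ 2 + _ ^+ 2); congr fine;
    by apply: eq_measure_integral => B mB _; exact: (idd (Some k) None).
have := minorant_charmod2 lam0 FG (w k).
rewrite lerBrDl -lerBrDr => /le_trans; apply.
by rewrite (le_trans _ (expR_ge1Dx _)).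
Qed.

End symmetrized_minorant.

(** * Smoothing inequality *)

(** Cauchy-Schwarz for the vectors [(E cos f, E sin f)] and [(cos c, sin c)]. *)
Lemma integral_cos_shift_le d (Omega : measurableType d) (R : realType)
    (P : probability Omega R) (f : Omega -> R) (c b : R) :
  measurable_fun [set: Omega] f -> 0 <= b -> charmod2 P f <= b ^+ 2 ->
  \int[P]_o cos (f o - c) <= b.
Proof.
move=> mf b0; rewrite /charmod2.
have -> : \int[P]_o cos (f o - c) =
    \int[P]_o cos (f o) * cos c + \int[P]_o sin (f o) * sin c.
  under eq_Rintegral do rewrite cosB.
  by rewrite bmintegralD ?bmintegralZr//;
    do ?[exact: bmfun_cos|exact: bmfun_sin|
    exact: (bmfunM (bmfun_cos mf) (bmfun_cst _))|
    exact: (bmfunM (bmfun_sin mf) (bmfun_cst _))].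
set C := \int[P]_x _; set S := \int[P]_x _ => CSb.
have cs := cos2Dsin2 c.
rewrite leNgt; apply/negP => h.
have : b ^+ 2 < (C * cos c + S * sin c) ^+ 2.
  by rewrite ltr_pXn2r// ?nnegrE// ltW// (le_lt_trans b0).
apply/negP; rewrite -leNgt (le_trans _ CSb)//.
have -> : C ^+ 2 + S ^+ 2 = (C ^+ 2 + S ^+ 2) * (cos c ^+ 2 + sin c ^+ 2).
  by rewrite cs mulr1.
rewrite -subr_ge0; have -> : (C ^+ 2 + S ^+ 2) * (cos c ^+ 2 + sin c ^+ 2) -
  (C * cos c + S * sin c) ^+ 2 = (C * sin c - S * cos c) ^+ 2 by ring.
exact: sqr_ge0.
Qed.

Section smoothing.
Context (R : realType) (d : nat).
Context (dQ : measure_display) (Om : measurableType dQ) (Q : probability Om R).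
Context (T : 'I_d -> Om -> R).
Hypothesis mT : forall i, measurable_fun [set: Om] (T i).
Hypothesis T_kernel : forall u : 'I_d -> R,
  \int[Q]_w cos (\sum_(i < d) u i * T i w) = \prod_(i < d) kernel (u i).

Lemma bmintegral_kernel_swap dO (Omega : measurableType dO)
    (P : probability Omega R) (U : 'I_d -> Omega -> R) :
  (forall i, measurable_fun [set: Omega] (U i)) ->
  \int[P]_o \prod_(i < d) kernel (U i o) =
  \int[Q]_w \int[P]_o cos (\sum_(i < d) U i o * T i w).
Proof.
move=> mU.
have mf : measurable_fun [set: Omega * Om]
    (fun z => \sum_(i < d) U i z.1 * T i z.2).
  apply: measurable_sum => i; apply: measurable_funM.
    exact: measurableT_comp (mU i) _.
  exact: measurableT_comp (mT i) _.
rewrite -(bmfubini P Q (bmfun_cos mf)).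
by apply: eq_Rintegral => o _; rewrite -T_kernel.
Qed.

(** An Esseen-type bound.  Only an upper bound [b] of the modulus of the
    characteristic function enters, so that no measurability of the modulus
    itself is at stake. *)
Lemma smoothing_inequality dO (Omega : measurableType dO)
    (P : probability Omega R) (S : 'I_d -> Omega -> R) (x : 'I_d -> R) (tau : R)
    (b : Om -> R) :
  0 < tau -> (forall i, measurable_fun [set: Omega] (S i)) -> bmfun b ->
  (forall w, 0 <= b w) ->
  (forall w,
    charmod2 P (fun o => \sum_(i < d) S i o / tau * T i w) <= b w ^+ 2) ->
  (P [set o | (\sum_(i < d) (S i o - x i) ^+ 2 <= (tau / 2) ^+ 2)%R] <=
   (4 ^+ d * \int[Q]_w b w)%:E)%E.
Proof.
move=> tau0 mS bb b0 hb.
set E := [set o | _].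
have mU i : measurable_fun [set: Omega] (fun o => (S i o - x i) / tau).
  by apply: measurable_funM => //; exact: measurable_funB.
have mE : measurable E.
  rewrite -[E]setTI; apply: measurable_fun_le => //.
  by apply: measurable_sum => i; apply: measurable_funX; exact: measurable_funB.
have bK : bmfun (fun o => \prod_(i < d) kernel ((S i o - x i) / tau)).
  by apply: bmfun_prod => i; exact: (bmfun_comp (mU i) bmfun_kernel).
rewrite -(bmintegral_indic P mE) lee_fin.
apply: (@le_trans _ _
    (\int[P]_o (4 ^+ d * \prod_(i < d) kernel ((S i o - x i) / tau)))).
  apply: le_bmintegral; [exact: bmfun_indic|exact: bmfunM (bmfun_cst _) bK|].
  move=> o; rewrite indicE; case: (boolP (o \in E)) => [|_]; last first.
    by rewrite mulr_ge0 ?exprn_ge0// prodr_ge0// => i _; exact: kernel_ge0.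
  rewrite inE /E/= => Eo.
  have -> : (4 : R) ^+ d = \prod_(i < d) 4 by rewrite prodr_const card_ord.
  rewrite -big_split/=.
  apply: (@le_trans _ _ (\prod_(i < d) 1)); first by rewrite big1_eq.
  apply: ler_prod => i _; rewrite ler01/= -ler_pdivrMl ?ltr0n// mulr1.
  (* inside the ball every coordinate of [(S - x) / tau] is at most 1/2 *)
  apply: kernel_ge_quarter; rewrite normrM normfV (gtr0_norm tau0).
  have t2 : 0 <= tau / 2 by rewrite divr_ge0// ltW.
  rewrite ler_pdivrMr// mulrC -(ger0_norm t2).
  rewrite -ler_sqr ?nnegrE// !real_normK ?num_real// (le_trans _ Eo)//.
  rewrite (bigD1 i)//= lerDl sumr_ge0// => j _; exact: sqr_ge0.
rewrite bmintegralZl// ler_pM2l ?exprn_gt0//.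
rewrite bmintegral_kernel_swap//.
apply: le_bmintegral => //.
  have mf : measurable_fun [set: Om * Omega]
      (fun z => \sum_(i < d) (S i z.2 - x i) / tau * T i z.1).
    apply: measurable_sum => i; apply: measurable_funM.
      exact: measurableT_comp (mU i) _.
    exact: measurableT_comp (mT i) _.
  exact: (bmfun_fubini_F Q P (bmfun_cos mf)).
move=> w.
pose c := \sum_(i < d) x i / tau * T i w.
rewrite -(_ : \int[P]_o cos (\sum_(i < d) S i o / tau * T i w - c) =
  \int[P]_o cos (\sum_(i < d) (S i o - x i) / tau * T i w)); last first.
  apply: eq_Rintegral => o _; congr cos; rewrite /c -sumrB.
  by apply: eq_bigr => i _; rewrite !mulrBl.
apply: integral_cos_shift_le => //.
by apply: measurable_sum => i; do 2 apply: measurable_funM => //.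
Qed.

End smoothing.

(** * Kernel means and cells *)

Section kernel_cells.
Context {R : realType}.
Variables (rho delta : R) (A : nat).
Hypotheses (delta0 : 0 < delta) (A0 : (0 < A)%N).
Hypothesis (rhoA : 2 <= A%:R * (`|rho| * delta)).

(** A telescoping majorant of [min (1, A^2 / p^2)], which bounds the kernel at
    distance [p] cells from the origin: [1 / (m (m + 1)) = 1 / m - 1 / (m + 1)]
    with [m = A + p], so that all the weights add up to at most [6 A]. *)
Let weight (p : nat) : R := 6 * A%:R ^+ 2 / ((A + p)%:R * (A + p).+1%:R).

Let weight_ge0 p : 0 <= weight p.
Proof. by rewrite divr_ge0 ?mulr_ge0 ?sqr_ge0. Qed.

Let sum_weight N : \sum_(0 <= p < N) weight p <= 6 * A%:R.
Proof.
have A0' : (A%:R : R) != 0 by rewrite pnatr_eq0 -lt0n.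
have -> : \sum_(0 <= p < N) weight p =
    6 * A%:R ^+ 2 * (A%:R^-1 - (A + N)%:R^-1).
  elim: N => [|N IH]; first by rewrite big_geq// addn0 subrr mulr0.
  rewrite big_nat_recr//= IH /weight addnS.
  have : ((A + N)%:R : R) != 0 by rewrite pnatr_eq0 addn_eq0 negb_and -lt0n A0.
  have : ((A + N).+1%:R : R) != 0 by rewrite pnatr_eq0.
  rewrite -[(A + N).+1%:R]natr1; move: A0'; move: (A%:R : R) ((A + N)%:R : R).
  by move=> a b a0 b1 b0; field; rewrite a0 b1 b0.
rewrite mulrBr lerBlDr -[leLHS]addr0 lerD//.
by rewrite le_eqVlt; apply/orP; left; apply/eqP; field.
Qed.

Let kernel_weight v (p := Num.truncn (`|v| / delta)) :
  kernel (rho * v) <= weight p.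
Proof.
have v0 : 0 <= `|v| / delta by rewrite divr_ge0// ltW.
have pv : p%:R * delta <= `|v| by rewrite -ler_pdivlMr// truncn_le.
have := kernel_le1 (rho * v); have := kernel_ge0 (rho * v).
have := kernel_decay (rho * v); set k := kernel _ => kd k0 k1.
have A1 : (1 : R) <= A%:R by rewrite ler1n.
have kp : k * p%:R ^+ 2 <= A%:R ^+ 2.
  have h : 2 * p%:R <= A%:R * `|rho * v|.
    rewrite normrM (le_trans (ler_wpM2r _ rhoA))//.
    rewrite -!mulrA ler_wpM2l// ler_wpM2l// mulrC//.
  have h2 : (2 * p%:R) ^+ 2 <= A%:R ^+ 2 * (rho * v) ^+ 2.
    by rewrite -[X in _ <= _ * X]real_normK ?num_real// -exprMn ler_sqr//
      nnegrE mulr_ge0.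
  have := ler_wpM2l k0 h2.
  have := ler_wpM2l (sqr_ge0 (A%:R : R)) kd.
  nra.
rewrite /weight ler_pdivlMr; last by rewrite mulr_gt0// ltr0n ?addn_gt0 ?A0.
rewrite -[(A + p).+1%:R]natr1 natrD.
have [pA|pA] := leP p A.
  have {}pA : (p%:R : R) <= A%:R by rewrite ler_nat.
  have p0 : (0 : R) <= p%:R by [].
  have h : (A%:R + p%:R) * (A%:R + p%:R + 1) <= 6 * A%:R ^+ 2 :> R by nra.
  rewrite (le_trans _ h)// ler_piMl// mulr_ge0//; lra.
have {}pA : (A%:R + 1 : R) <= p%:R by rewrite natr1 ler_nat.
have h : (A%:R + p%:R) * (A%:R + p%:R + 1) <= 4 * p%:R ^+ 2 :> R by nra.
rewrite (le_trans (ler_wpM2l k0 h))//; have := sqr_ge0 (A%:R : R); lra.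
Qed.

Section cells.
Context d (Omega : measurableType d) (H : probability Omega R).

Let cell (v : Omega -> R) (c : R) : set Omega :=
  [set o | c <= v o <= c + delta].

Let measurable_cell v c :
  measurable_fun [set: Omega] v -> measurable (cell v c).
Proof.
move=> mv; have -> : cell v c = v @^-1` `[c, c + delta]%classic.
  by apply/seteqP; split=> o /=; rewrite in_itv.
by rewrite -[_ @^-1` _]setTI; exact: mv.
Qed.

(** The line is covered by the cells from [p delta] to [(p + 1) delta] and their
    mirror images, on which the kernel is at most [weight p]; summing the two
    families gives [2 * 6 A]. *)
Lemma kernel_mean_cells1 (v g : Omega -> R) (K : R) :
  measurable_fun [set: Omega] v -> bmfun g -> (forall o, 0 <= g o) ->
  bmfun (fun o => kernel (rho * v o)) ->
  (forall c, \int[H]_o (g o * \1_(cell v c) o) <= K) ->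
  \int[H]_o (g o * kernel (rho * v o)) <= 12 * A%:R * K.
Proof.
move=> mv bg g0 bk hK.
pose cp (p : nat) : R := p%:R * delta.
pose cm (p : nat) : R := - (p.+1%:R * delta).
pose f p o : R :=
  weight p * (g o * \1_(cell v (cp p)) o + g o * \1_(cell v (cm p)) o).
have b1 c : bmfun (fun o => g o * \1_(cell v c) o).
  by apply: bmfunM => //; apply: bmfun_indic; exact: measurable_cell.
have bf p : bmfun (f p) by apply: bmfunM; [exact: bmfun_cst|exact: bmfunD].
have f0 p o : 0 <= f p o.
  by rewrite mulr_ge0// addr_ge0// mulr_ge0.
have fK p : \int[H]_o f p o <= weight p * (2 * K).
  rewrite bmintegralZl; last exact: bmfunD.
  by rewrite ler_wpM2l// bmintegralD// mulr_natl mulr2n lerD.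
have K0 : 0 <= K.
  apply: le_trans (hK 0); rewrite Rintegral_ge0// => o _; exact: mulr_ge0.
have bgk : bmfun (fun o => g o * kernel (rho * v o)) by exact: bmfunM.
rewrite -lee_fin EFin_bmintegral//.
apply: (@le_trans _ _ (\int[H]_o \sum_(0 <= p <oo) (f p o)%:E)%E).
  apply: ge0_le_integral => //.
  - by move=> o _; rewrite lee_fin mulr_ge0// kernel_ge0.
  - by apply/measurable_EFinP; exact: bgk.1.
  - apply: ge0_emeasurable_sum => [p o _ _|p _]; first by rewrite lee_fin.
    by apply/measurable_EFinP; exact: (bf p).1.
  move=> o _; pose p := Num.truncn (`|v o| / delta).
  apply: (@le_trans _ _ (\sum_(0 <= q < p.+1) (f q o)%:E)%E); last first.
    by apply: nneseries_lim_ge => q _ _; rewrite lee_fin.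
  rewrite sumEFin lee_fin big_nat_recr//= -[leLHS]add0r lerD ?sumr_ge0//.
  rewrite /f -mulrDr mulrCA ler_wpM2l//.
  rewrite (le_trans (kernel_weight (v o)))// -/p -[leLHS]mulr1 ler_wpM2l//.
  have vd : 0 <= `|v o| / delta by rewrite divr_ge0// ltW.
  have /andP[pl pu] : p%:R * delta <= `|v o| <= p.+1%:R * delta.
    apply/andP; split; first by rewrite -ler_pdivlMr// truncn_le.
    by rewrite ltW// -ltr_pdivrMr// truncnS_gt.
  have [vo0|vo0] := leP 0 (v o).
    rewrite ger0_norm// in pl pu.
    rewrite [X in X + _]indicE mem_set ?lerDl//= /cell/= /cp pl/=.
    by rewrite (le_trans pu)// -natr1 mulrDl mul1r.
  rewrite ltr0_norm// in pl pu.
  rewrite [X in _ + X]indicE mem_set ?lerDr//= /cell/= /cm.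
  by rewrite lerNl pu/= -natr1 mulrDl mul1r opprD subrK lerNr.
rewrite integral_nneseries//; last 2 first.
- by move=> p; apply/measurable_EFinP; exact: (bf p).1.
- by move=> p o _; rewrite lee_fin.
apply: lime_le.
  apply: is_cvg_nneseries => p _ _.
  by apply: integral_ge0 => o _; rewrite lee_fin.
apply: nearW => N.
under eq_bigr do rewrite -EFin_bmintegral//.
rewrite sumEFin lee_fin.
apply: (@le_trans _ _ (\sum_(0 <= p < N) weight p * (2 * K))).
  exact: ler_sum.
rewrite -mulr_suml (le_trans (ler_wpM2r _ (sum_weight N))) ?mulr_ge0//.
by rewrite le_eqVlt; apply/orP; left; apply/eqP; ring.
Qed.

End cells.

(** The kernels are traded one coordinate at a time for indicators of cells,
    which avoids summing over a lattice of dimension [n]. *)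
Lemma kernel_mean_le_cells n d (Omega : measurableType d)
    (H : probability Omega R) (Y : 'I_n -> Omega -> R) (q : R) :
  (forall i, measurable_fun [set: Omega] (Y i)) ->
  (forall i, bmfun (fun o => kernel (rho * Y i o))) ->
  (forall c : 'I_n -> R,
    (H [set o | forall i, (c i <= Y i o <= c i + delta)%R] <= q%:E)%E) ->
  \int[H]_o \prod_(i < n) kernel (rho * Y i o) <= (12 * A%:R) ^+ n * q.
Proof.
move=> mY bkY hq.
pose cell i c : set Omega := [set o | c <= Y i o <= c + delta].
have mcell i c : measurable (cell i c).
  have -> : cell i c = Y i @^-1` `[c, c + delta]%classic.
    by apply/seteqP; split=> o /=; rewrite in_itv.
  by rewrite -[_ @^-1` _]setTI; exact: mY.
(* [s] lists the coordinates that still carry a kernel *)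
suff key (s : seq 'I_n) : uniq s -> forall c : 'I_n -> R,
    \int[H]_o (\prod_(i <- s) kernel (rho * Y i o) *
      \prod_(i | i \notin s) \1_(cell i (c i)) o) <= (12 * A%:R) ^+ size s * q.
  have := key (index_enum 'I_n) (index_enum_uniq _) (fun=> 0).
  have -> : size (index_enum 'I_n) = n.
    by rewrite [index_enum _]unlock -enumT size_enum_ord.
  apply: le_trans; rewrite le_eqVlt; apply/orP; left; apply/eqP.
  apply: eq_Rintegral => o _; rewrite [X in _ * X]big1 ?mulr1// => i.
  by rewrite mem_index_enum.
elim: s => [_ c|i s IH /= /andP[si us] c].
  rewrite expr0 mul1r -lee_fin (le_trans _ (hq c))//.
  under eq_Rintegral do rewrite big_nil mul1r.
  have -> : [set o | forall i, (c i <= Y i o <= c i + delta)%R] =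
      \bigcap_(i in [set: 'I_n]) cell i (c i).
    by apply/seteqP; split=> o /= h i; [move=> _; exact: h|exact: (h i I)].
  have mc : measurable (\bigcap_(i in [set: 'I_n]) cell i (c i)).
    by apply: fin_bigcap_measurable => // ; exact: finite_finset.
  rewrite -(bmintegral_indic H mc) lee_fin le_eqVlt; apply/orP; left; apply/eqP.
  apply: eq_Rintegral => o _; rewrite indicE.
  have [/set_mem h|/negP h] := boolP (o \in _).
    by rewrite big1// => i _; rewrite indicE mem_set//; exact: h.
  apply/eqP; rewrite prodf_seq_eq0; apply/hasP; apply: contra_notP h => h.
  apply/mem_set => i _; apply: contra_notP h => h.
  exists i; rewrite ?mem_index_enum//=.
  by rewrite indicE memNset.
pose g o := \prod_(j <- s) kernel (rho * Y j o) *
   \prod_(j | j \notin i :: s) \1_(cell j (c j)) o : R.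
have g0 o : 0 <= g o.
  by rewrite mulr_ge0// prodr_ge0// => j _; exact: kernel_ge0.
have bg : bmfun g.
  apply: bmfunM; first by apply: bmfun_prod => j; exact: bkY.
  under eq_fun do rewrite -big_filter.
  by apply: bmfun_prod => j; exact: bmfun_indic.
have -> : \int[H]_o (\prod_(j <- i :: s) kernel (rho * Y j o) *
      \prod_(j | j \notin i :: s) \1_(cell j (c j)) o) =
    \int[H]_o (g o * kernel (rho * Y i o)).
  by apply: eq_Rintegral => o _; rewrite big_cons /g -mulrA mulrC.
rewrite exprS -mulrA; apply: kernel_mean_cells1 => // c0.
pose c' j := if j == i then c0 else c j.
rewrite (le_trans _ (IH us c'))// le_eqVlt; apply/orP; left; apply/eqP.
apply: eq_Rintegral => o _; rewrite /g -mulrA; congr (_ * _).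
rewrite [RHS](bigD1 i)//= {1}/c' eqxx mulrC; congr (_ * _).
apply: eq_big => [j|j]; rewrite inE negb_or andbC// => /andP[_ ji].
by rewrite /c' (negbTE ji).
Qed.

End kernel_cells.

(** * Coordinates, balls and cubes in R^d *)

Section borel_Rd.
Context {R : realType} {d : nat}.

(** The Borel sets come from the topology of the sup norm, for which coordinates
    are continuous. *)
Lemma measurable_coord (i : 'I_d) :
  measurable_fun [set: borelRd R d]
    (fun y : borelRd R d => (y : 'rV[R]_d) ord0 i).
Proof.
apply: (measurability _ (RGenOpens.measurableE R)).
move=> _ [_ [x [y ->]] <-]; rewrite setTI.
apply: sub_sigma_algebra.
apply: (@open_comp _ _ (fun M : 'rV[R]_d => M ord0 i)) => [M _|].
  exact: coord_continuous.
exact: interval_open.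
Qed.

(** Balls are described by coordinates, with squares in place of the norm, which
    makes their measurability evident. *)
Lemma ball_coordE (x : 'rV[R]_d) (r : R) : 0 < r ->
  [set x + r *: b | b in half_ball] =
  [set y : 'rV[R]_d | \sum_(i < d) (y ord0 i - x ord0 i) ^+ 2 <= (r / 2) ^+ 2].
Proof.
move=> r0.
have ballE (b : 'rV[R]_d) : (enorm b <= 2^-1) =
    (\sum_(i < d) b ord0 i ^+ 2 <= 2^-1 ^+ 2).
  rewrite /enorm /dotv; under eq_bigr do rewrite -expr2.
  have s0 : 0 <= \sum_(i < d) b ord0 i ^+ 2.
    by rewrite sumr_ge0// => i _; exact: sqr_ge0.
  by rewrite -ler_sqr ?nnegrE ?sqrtr_ge0// sqr_sqrtr.
apply/seteqP; split=> [_ [b hb <-]|y /= hy].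
  move: hb; rewrite /half_ball/= ballE => hb.
  under eq_bigr do rewrite !mxE addrAC subrr add0r exprMn.
  by rewrite -mulr_sumr exprMn ler_pM2l// exprn_gt0.
exists (r^-1 *: (y - x)); last first.
  by rewrite scalerA divff ?gt_eqF// scale1r addrC subrK.
rewrite /half_ball/= ballE; under eq_bigr do rewrite !mxE exprMn.
rewrite -mulr_sumr (exprVn r) [leLHS]mulrC ler_pdivrMr ?exprn_gt0//.
by rewrite -exprMn [_ * r]mulrC.
Qed.

(** A cube of side [eps / d] has diameter at most [eps]. *)
Lemma cell_le_concentration (H : probability (borelRd R d) R) (eps : R)
    (c : 'I_d -> R) : 0 < eps ->
  (H [set y : borelRd R d | forall i,
     (c i <= (y : 'rV[R]_d) ord0 i <= c i + eps / d%:R)%R] <=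
   concentration H eps)%E.
Proof.
move=> eps0; set C := [set y | _].
pose x : 'rV[R]_d := \row_i (c i + eps / d%:R / 2).
pose B : set 'rV[R]_d := [set x + eps *: b | b in half_ball].
have CB : C `<=` B.
  rewrite /B ball_coordE// => y Cy /=.
  have [d0|d0] := posnP d.
    rewrite big1 ?sqr_ge0// => i _; have := ltn_ord i; by rewrite {2}d0.
  have d1 : (1 : R) <= d%:R by rewrite ler1n.
  have dpos : (0 : R) < d%:R by rewrite ltr0n.
  apply: (@le_trans _ _ (\sum_(i < d) (eps / d%:R / 2) ^+ 2)).
    apply: ler_sum => i _; rewrite mxE.
    have /andP[c1 c2] := Cy i.
    move: c1 c2; set e := eps / d%:R; set yi := y _ _; nra.
  rewrite sumr_const card_ord -[leLHS]mulr_natl.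
  have -> : d%:R * (eps / d%:R / 2) ^+ 2 = (eps / 2) ^+ 2 * d%:R^-1.
    by field; rewrite gt_eqF.
  by rewrite ler_piMr ?sqr_ge0// invf_le1.
have mB : measurable (B : set (borelRd R d)).
  rewrite /B ball_coordE// -[X in measurable X]setTI.
  apply: measurable_fun_le => //.
  apply: measurable_sum => i; apply: measurable_funX.
  apply: measurable_funB => //.
  exact: measurable_coord.
have mC : measurable C.
  have -> : C = \bigcap_(i in [set: 'I_d])
      ((fun y : borelRd R d => (y : 'rV[R]_d) ord0 i) @^-1`
        `[c i, c i + eps / d%:R]%classic).
    apply/seteqP; split=> y /= h i.
      by move=> _ /=; rewrite in_itv/=; exact: h.
    by have := h i I; rewrite /= in_itv.
  apply: fin_bigcap_measurable; first exact: finite_finset.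
  by move=> i _; rewrite -[_ @^-1` _]setTI; exact: measurable_coord.
apply: (@le_trans _ _ (H B)); first by apply: le_measure; rewrite ?inE.
by apply: ereal_sup_ubound; exists x.
Qed.

Lemma concentration_le1 (H : probability (borelRd R d) R) (eps : R) : 0 < eps ->
  (concentration H eps <= 1)%E.
Proof.
move=> eps0; apply: ge_ereal_sup => _ [x _ <-]; apply: probability_le1.
rewrite ball_coordE// -[X in measurable X]setTI.
apply: measurable_fun_le => //.
apply: measurable_sum => i; apply: measurable_funX.
apply: measurable_funB => //.
exact: measurable_coord.
Qed.

End borel_Rd.

(** * Jensen inequality and the logarithmic weight *)

(** Integrate the tangent line inequality
    [exp (- g) >= exp (- m) (1 + m - g)] at the mean [m] of [g]. *)
Lemma expR_jensen d (T : measurableType d) (R : realType) (F : probability T R)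
    (g : T -> R) :
  F.-integrable [set: T] (EFin \o g) -> bmfun (fun z => expR (- g z)) ->
  expR (- \int[F]_z g z) <= \int[F]_z expR (- g z).
Proof.
move=> ig bg; set m := \int[F]_z g z.
have i1 : F.-integrable [set: T] (EFin \o (fun=> 1 + m)).
  exact: (bmfun_integrable F (bmfun_cst (1 + m))).
have i2 : F.-integrable [set: T] (EFin \o (fun z => 1 + m - g z)).
  exact: (integrableB measurableT i1 ig).
rewrite -[leLHS]mulr1.
have {1}-> : (1 : R) = \int[F]_z (1 + m - g z).
  by rewrite RintegralB// prob_bmintegral_cst -/m addrK.
rewrite -RintegralZl//; apply: le_Rintegral => //.
- exact: (integrableZl measurableT _ i2).
- exact: bmfun_integrable.
move=> z _; rewrite -ler_pdivlMl ?expR_gt0// -expRN opprK -expRD.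
by rewrite (le_trans _ (expR_ge1Dx _))// addrA.
Qed.

Section log_weight.
Context {R : realType} (tau eps : R).
Hypotheses (tau0 : 0 < tau) (eps0 : 0 < eps).

Let ratio (z : R) : R := tau * (eps * `|z|)^-1.

(** The smallest integer that is at least [ratio z]: the number of intervals of
    length [eps] needed to cover one of length [tau / |z|]. *)
Definition blocks (z : R) : R := 1 + (strict_floor (ratio z))%:~R.

Lemma blocksE (z : R) : z != 0 ->
  exists2 w : nat, (0 < w)%N & blocks z = w%:R /\ ratio z <= w%:R.
Proof.
move=> z0; have r0 : 0 < ratio z.
  by rewrite mulr_gt0// invr_gt0 mulr_gt0// normr_gt0.
have c0 : 0 < Num.ceil (ratio z) by rewrite ceil_gt0.
exists `|Num.ceil (ratio z)|%N; first by rewrite absz_gt0 gt_eqF.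
have cE : (`|Num.ceil (ratio z)|%N)%:R = (Num.ceil (ratio z))%:~R :> R.
  by rewrite natr_absz gtr0_norm.
rewrite cE; split; last exact: ceil_ge.
by rewrite /blocks /strict_floor intrD addrC subrK.
Qed.

Lemma log_ratio_blocks (z : R) : z != 0 ->
  log_ratio tau eps z = (ln (blocks z))%:E.
Proof. by move=> z0; rewrite /log_ratio (negbTE z0). Qed.

Lemma log_ratio_ge0 (z : R) : (0 <= log_ratio tau eps z)%E.
Proof.
have [->|z0] := eqVneq z 0; first by rewrite /log_ratio eqxx.
have [w w0 [wE _]] := blocksE z0.
by rewrite log_ratio_blocks// lee_fin wE ln_ge0// ler1n.
Qed.

Lemma measurable_blocks : measurable_fun [set: R] blocks.
Proof.
apply: measurable_funD => //.
have mc : measurable_fun [set: R] (fun x : R => (strict_floor x)%:~R : R).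
  apply: nondecreasing_measurable => // x y xy.
  by rewrite ler_int /strict_floor lerB// le_ceil.
apply: (measurableT_comp mc).
apply: measurable_funM => //.
rewrite (_ : (fun x => _) = (fun x : R => (eps * `|x|) `^ (-1))); last first.
  by apply/funext => x; rewrite powR_inv1// mulr_ge0// ltW.
apply: (measurableT_comp (measurable_powR (-1))).
by apply: measurable_funM => //; exact: measurableT_comp.
Qed.

Lemma measurable_log_ratio : measurable_fun [set: R] (log_ratio tau eps).
Proof.
apply: measurable_fun_ifT => //=.
  exact: measurable_fun_eqr.
apply/measurable_EFinP; apply: measurableT_comp; first exact: measurable_ln.
exact: measurable_blocks.
Qed.

End log_weight.

(** * The comparison inequality *)

Section comparison.
Context (R : realType) (d n : nat) (a : 'I_n -> 'rV[R]_d).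
Context (dQ : measure_display) (Om : measurableType dQ) (Q : probability Om R).
Context (T : 'I_d -> Om -> R).
Hypothesis mT : forall i, measurable_fun [set: Om] (T i).
Hypothesis T_kernel : forall u : 'I_d -> R,
  \int[Q]_w cos (\sum_(i < d) u i * T i w) = \prod_(i < d) kernel (u i).
Variables (lam tau eps : R).
Hypotheses (d0 : (0 < d)%N) (lam0 : 0 <= lam) (tau0 : 0 < tau) (eps0 : 0 < eps).

(** The scalar product of [T / tau] with [a k]. *)
Let freq (w : Om) (k : 'I_n) : R := \sum_(i < d) a k ord0 i / tau * T i w.

(** Minus the logarithm of the characteristic function of the power [lam] of
    [H_1] at [z T / tau]. *)
Let energy (w : Om) (z : R) : R :=
  lam / 2 * \sum_(k < n) (1 - cos (freq w k * z)).

Let measurable_freq k : measurable_fun [set: Om] (freq ^~ k).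
Proof. by apply: measurable_sum => i; exact: measurable_funM. Qed.

Let bmfun_energy : bmfun (fun p : Om * R => energy p.1 p.2).
Proof.
apply: bmfunM; first exact: bmfun_cst.
apply: bmfun_sum => k; apply: bmfunB; first exact: bmfun_cst.
apply: bmfun_cos; apply: measurable_funM => //.
exact: measurableT_comp (measurable_freq k) _.
Qed.

Let energy_ge0 w z : 0 <= energy w z.
Proof.
by rewrite mulr_ge0 ?divr_ge0// sumr_ge0// => k _; rewrite subr_ge0 cos_le1.
Qed.

Let energy_le w z : energy w z <= lam * n%:R.
Proof.
have -> : lam * n%:R = lam / 2 * \sum_(k < n) (2 : R).
  by rewrite sumr_const card_ord -mulr_natr; field.
rewrite ler_wpM2l ?divr_ge0// ler_sum// => k _.
by have := cos_geN1 (freq w k * z); lra.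
Qed.

Section power_of_H1.
Variable H : probability (borelRd R d) R.
Hypothesis hH : is_H1_power a lam H.

Let coord i (y : borelRd R d) : R := (y : 'rV[R]_d) ord0 i.

Let charfun_energy w z :
  expR (- energy w z) =
  \int[H]_y cos (\sum_(i < d) z / tau * coord i y * T i w).
Proof.
pose t : 'rV[R]_d := \row_i (z / tau * T i w).
have := congr1 (@complex.Re R) (hH t); rewrite /charfun/=.
have -> : \int[H]_y cos (\sum_(i < d) z / tau * coord i y * T i w) =
    \int[H]_y cos (dotv t y).
  apply: eq_Rintegral => y _; congr cos; apply: eq_bigr => i _.
  by rewrite mxE mulrAC.
move=> ->; rewrite /charfun_H1 -expRM; congr expR.
have -> : \sum_(k < n) (1 - cos (dotv t (a k))) =
    \sum_(k < n) (1 - cos (freq w k * z)).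
  apply: eq_bigr => k _; congr (1 - cos _).
  rewrite /freq /dotv mulr_suml; apply: eq_bigr => i _.
  by rewrite mxE; ring.
by rewrite /energy; field.
Qed.

Lemma energy_mean_le (z : R) : z != 0 ->
  \int[Q]_w expR (- energy w z) <=
  (24 * d%:R * blocks tau eps z) ^+ d * fine (concentration H eps).
Proof.
move=> z0; have [w w0 [-> rw]] := blocksE tau0 eps0 z0.
have dR0 : (0 : R) < d%:R by rewrite ltr0n.
have zn : 0 < `|z| by rewrite normr_gt0.
have delta0 : 0 < eps / d%:R by rewrite divr_gt0.
have A0 : (0 < 2 * d * w)%N by rewrite !muln_gt0 d0 w0.
have rhoA : 2 <= (2 * d * w)%:R * (`|z / tau| * (eps / d%:R)).
  rewrite normrM normfV (gtr0_norm tau0) !natrM.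
  have -> : 2 * d%:R * w%:R * (`|z| / tau * (eps / d%:R)) =
      2 * (w%:R * (`|z| / tau * eps)) :> R.
    by field; rewrite !gt_eqF.
  rewrite ler_peMr// -ler_pdivrMr ?mulr_gt0 ?invr_gt0// (le_trans _ rw)//.
  by rewrite le_eqVlt; apply/orP; left; apply/eqP; field; rewrite !gt_eqF.
under eq_Rintegral do rewrite charfun_energy.
have mU i : measurable_fun [set: borelRd R d] (fun y => z / tau * coord i y).
  by apply: measurable_funM => //; exact: measurable_coord.
rewrite -(bmintegral_kernel_swap mT T_kernel H mU).
have -> : 24 * d%:R * w%:R = 12 * (2 * d * w)%:R :> R.
  by rewrite !natrM; ring.
have cfin : concentration H eps \is a fin_num.
  rewrite ge0_fin_numE.
    by rewrite (le_lt_trans (concentration_le1 H eps0))// ltry.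
  apply: le_trans (ereal_sup_ubound _); last by exists 0.
  exact: measure_ge0.
apply: (kernel_mean_le_cells delta0 A0 rhoA).
- by move=> i; exact: measurable_coord.
- by move=> i; exact: (bmfun_comp (mU i) bmfun_kernel).
- by move=> c; rewrite fineK//; exact: cell_le_concentration.
Qed.

(** The mean in [energy_mean_le] is positive because the energy is bounded. *)
Lemma concentration_H_gt0 : 0 < fine (concentration H eps).
Proof.
have := energy_mean_le (oner_neq0 R).
have [w w0 [-> _]] := blocksE tau0 eps0 (oner_neq0 R).
apply: contraTT; rewrite -leNgt -ltNge => q0.
apply: (@le_lt_trans _ _ 0).
  by rewrite mulr_ge0_le0// exprn_ge0// mulr_ge0.
apply: (@lt_le_trans _ _ (expR (- (lam * n%:R)))); first exact: expR_gt0.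
rewrite -(prob_bmintegral_cst Q (expR _)); apply: le_bmintegral.
- exact: bmfun_cst.
- apply: bmfun_expRN => // w'.
  exact: (bmfun_pairr bmfun_energy 1).1.
- by move=> w'; rewrite ler_expR lerN2.
Qed.

Section averaging.
Variable F : probability R R.
Hypothesis F0 : F [set 0] = 0%E.

Let lw (z : R) : R := fine (log_ratio tau eps z).

Hypothesis lw_integrable : F.-integrable [set: R] (EFin \o lw).

Let lw_ge0 z : 0 <= lw z.
Proof. by rewrite fine_ge0// log_ratio_ge0. Qed.

Let mlw : measurable_fun [set: R] lw.
Proof. by apply/measurable_EFinP; exact: measurable_int lw_integrable. Qed.

Let mG : measurable_fun [set: Om * R] (fun p => energy p.1 p.2 + d%:R * lw p.2).
Proof.
apply: measurable_funD; first exact: bmfun_energy.1.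
by apply: measurable_funM => //; exact: measurableT_comp.
Qed.

Let G_ge0 (p : Om * R) : 0 <= energy p.1 p.2 + d%:R * lw p.2.
Proof. by rewrite addr_ge0// mulr_ge0. Qed.

Let bG : bmfun (fun p : Om * R => expR (- (energy p.1 p.2 + d%:R * lw p.2))).
Proof. exact: bmfun_expRN. Qed.

(** At [z = 0] the weight is infinite and [lw 0 = 0] is only a default value:
    there the trivial bound 1 is used, and the indicator is later integrated
    against [F [set 0] = 0]. *)
Let section_le z :
  \int[Q]_w expR (- (energy w z + d%:R * lw z)) <=
  (24 * d%:R) ^+ d * fine (concentration H eps) + \1_[set 0] z.
Proof.
have q0 := ltW concentration_H_gt0.
have c0 : 0 <= (24 * d%:R) ^+ d * fine (concentration H eps).
  by rewrite mulr_ge0// exprn_ge0// mulr_ge0.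
have [->|z0] := eqVneq z 0.
  rewrite indicE mem_set//= -[leLHS]add0r lerD//.
  rewrite -[leRHS](prob_bmintegral_cst Q); apply: le_bmintegral.
  - exact: (bmfun_pairr bG 0).
  - exact: bmfun_cst.
  - by move=> w; rewrite -[leRHS]expR0 ler_expR oppr_le0; exact: (G_ge0 (w, 0)).
have be : bmfun (fun w => expR (- energy w z)).
  by apply: bmfun_expRN => //; exact: (bmfun_pairr bmfun_energy z).1.
under eq_Rintegral do rewrite opprD expRD.
rewrite bmintegralZr// -[leLHS]addr0 lerD//.
rewrite expRN ler_pdivrMr ?expR_gt0//.
rewrite (le_trans (energy_mean_le z0))//.
have [w w0 [wE _]] := blocksE tau0 eps0 z0.
have -> : expR (d%:R * lw z) = blocks tau eps z ^+ d.
  by rewrite /lw log_ratio_blocks//= expRM_natl lnK// wE posrE ltr0n.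
by rewrite exprMn mulrAC.
Qed.

(** Jensen for each frequency, then Fubini to reach [section_le]. *)
Lemma averaged_energy_le :
  \int[Q]_w expR (- \int[F]_z energy w z) <=
  expR (d%:R * \int[F]_z lw z) *
  ((24 * d%:R) ^+ d * fine (concentration H eps)).
Proof.
have b1 : bmfun (fun w => \int[F]_z energy w z).
  exact: (bmfun_fubini_F Q F bmfun_energy).
have i0 w : 0 <= \int[F]_z energy w z by exact: Rintegral_ge0.
have bF := bmfun_fubini_F Q F bG.
apply: (@le_trans _ _ (expR (d%:R * \int[F]_z lw z) *
    \int[Q]_w \int[F]_z expR (- (energy w z + d%:R * lw z)))).
  rewrite -bmintegralZl//; apply: le_bmintegral => [||w].
  - by apply: bmfun_expRN => //; exact: b1.1.
  - exact: bmfunM (bmfun_cst _) bF.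
  have be : bmfun (energy w) by exact: (bmfun_pairl bmfun_energy w).
  have dl : F.-integrable [set: R] (EFin \o (fun z => d%:R * lw z)).
    exact: (integrableZl measurableT _ lw_integrable).
  have il : F.-integrable [set: R]
      (EFin \o (fun z => energy w z + d%:R * lw z)).
    exact: (integrableD measurableT (bmfun_integrable F be) dl).
  have := expR_jensen il (bmfun_pairl bG w).
  rewrite RintegralD//; last exact: bmfun_integrable.
  by rewrite RintegralZl// opprD expRD [expR (- (_ * _))]expRN
    ler_pdivrMr ?expR_gt0// mulrC.
rewrite ler_pM2l ?expR_gt0// (bmfubini Q F bG).
apply: (@le_trans _ _ (\int[F]_z
    ((24 * d%:R) ^+ d * fine (concentration H eps) + \1_[set 0] z))).
  apply: le_bmintegral => //.
    have bG' := bmfun_comp (@measurable_swap _ _ R Om) bG.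
    exact: (bmfun_fubini_F F Q bG').
  by apply: bmfunD; [exact: bmfun_cst|exact: bmfun_indic].
rewrite bmintegralD ?prob_bmintegral_cst//;
  [|exact: bmfun_cst|exact: bmfun_indic].
have /eqP : (\int[F]_z \1_[set 0] z)%:E = 0%E by rewrite bmintegral_indic// F0.
by rewrite eqe => /eqP ->; rewrite addr0.
Qed.

Lemma probability_ball_le dO (Omega : measurableType dO)
    (P : probability Omega R) (X : {RV P >-> R}) (Xs : 'I_n -> {RV P >-> R})
    (x : 'rV[R]_d) :
  iid (oapp Xs X) ->
  (forall B, measurable B -> (lam%:E * F B <= symmetrized_law X B)%E) ->
  (P (weighted_sum Xs a @^-1` [set (x + tau *: b)%R | b in half_ball]) <=
   ((96 * d%:R) ^+ d * fine (concentration H eps) *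
     expR (d%:R * \int[F]_z lw z))%:E)%E.
Proof.
move=> XX FG; rewrite ball_coordE//.
pose S i o : R := \sum_(k < n) a k ord0 i * Xs k o.
have mS i : measurable_fun [set: Omega] (S i).
  by apply: measurable_sum => k; exact: measurable_funM.
have b1 : bmfun (fun w => \int[F]_z energy w z).
  exact: (bmfun_fubini_F Q F bmfun_energy).
have i0 w : 0 <= \int[F]_z energy w z by exact: Rintegral_ge0.
have bb : bmfun (fun w => expR (- \int[F]_z energy w z)).
  by apply: bmfun_expRN => //; exact: b1.1.
have -> : weighted_sum Xs a @^-1`
      [set y : 'rV[R]_d | \sum_(i < d) (y ord0 i - x ord0 i) ^+ 2 <=
        (tau / 2) ^+ 2] =
    [set o | (\sum_(i < d) (S i o - x ord0 i) ^+ 2 <= (tau / 2) ^+ 2)%R].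
  apply/funext => o; rewrite /preimage /mkset; congr (is_true (_ <= _)).
  apply: eq_bigr => i _; congr ((_ - _) ^+ 2).
  by rewrite /weighted_sum summxE; apply: eq_bigr => k _; rewrite mxE mulrC.
apply: (le_trans (smoothing_inequality mT T_kernel (x ord0) tau0 mS bb _ _)).
- by move=> w; exact: expR_ge0.
- move=> w.
  have -> : (fun o => \sum_(i < d) S i o / tau * T i w) =
      (fun o => \sum_(k < n) freq w k * Xs k o).
    apply/funext => o; under eq_bigr do rewrite /S -mulrA mulr_suml.
    rewrite exchange_big/=; apply: eq_bigr => k _.
    by rewrite /freq mulr_suml; apply: eq_bigr => i _; ring.
  rewrite (le_trans (charmod2_iid_sum_le (freq w) XX lam0 FG))//.
  rewrite -expRM_natl ler_expR mulrN lerN2 /energy.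
  rewrite bmintegralZl; last by apply: bmfun_sum => k; exact: bmfun_1Bcos.
  by rewrite mulrA (_ : 2%:R * (lam / 2) = lam)//; field.
rewrite lee_fin (le_trans (ler_wpM2l _ averaged_energy_le)) ?exprn_ge0//.
rewrite (_ : 96 * d%:R = 4 * (24 * d%:R)); last by ring.
rewrite [X in _ <= X * _ * _]exprMn.
by rewrite le_eqVlt; apply/orP; left; apply/eqP; ring.
Qed.

End averaging.
End power_of_H1.
End comparison.

Theorem theorem1 (R : realType) (d : nat) (hd : (0 < d)%N) :
  exists c : R, 0 < c /\
  forall (n : nat) (hn : (0 < n)%N)
    (dO : measure_display) (Omega : measurableType dO)
    (P : probability Omega R)
    (X : {RV P >-> R}) (Xs : 'I_n -> {RV P >-> R}) (hX : iid (oapp Xs X))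
    (a : 'I_n -> 'rV[R]_d)
    (V : {measure set R -> \bar R})
    (hV0 : (0 < V [set: R])%E)
    (hVG : forall B : set R, measurable B -> (V B <= symmetrized_law X B)%E)
    (H : probability (borelRd R d) R)
    (hH : is_H1_power a (fine (V [set: R])) H)
    (eps tau : R) (heps : 0 < eps) (htau : 0 < tau),
  (concentration (pushforward P (weighted_sum Xs a)) tau <=
   c%:E * concentration H eps *
   expeR (d%:R%:E * \int[normalized V]_z log_ratio tau eps z))%E.
Proof.
(* 96 = 4 * 24: 4 from the kernel on the ball, 24 from the cell count *)
pose cd : R := (96 * d%:R) ^+ d.
have cd0 : 0 < cd by rewrite exprn_gt0// mulr_gt0// ltr0n.
exists cd; split=> // n hn dO Omega P X Xs hX a V hV0 hVG H hH.
move=> eps tau heps htau.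
have [dQ [Om [Q [T [mT TE]]]]] := exists_kernel_frequency R d.
have T_kernel u := (TE u).1.
set lam := fine (V [set: R]) in hH.
have VT1 : (V [set: R] <= 1)%E.
  apply: le_trans (hVG _ measurableT) _; rewrite /symmetrized_law /pushforward.
  by rewrite preimage_setT probability_setT.
have Vfin : V [set: R] \is a fin_num.
  by rewrite ge0_fin_numE// (le_lt_trans VT1)// ltry.
have VE : V [set: R] = lam%:E by rewrite fineK.
have lam0 : 0 < lam by rewrite -lte_fin -VE.
pose F : probability R R := mnormalize V (@dirac _ R 0 R).
have FE B : F B = (V B * (lam^-1)%:E)%E.
  rewrite /F/= /mnormalize VE ifF//.
  by rewrite eqe gt_eqF.
have FG B : measurable B -> (lam%:E * F B <= symmetrized_law X B)%E.
  move=> mB; rewrite FE muleCA -EFinM divff ?gt_eqF// mule1.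
  exact: hVG.
have -> : (\int[normalized V]_z log_ratio tau eps z =
    \int[F]_z log_ratio tau eps z)%E.
  apply: eq_measure_integral => B mB _.
  by rewrite /normalized/= /mscale/= muleC; exact/esym/FE.
have mlr := measurable_log_ratio tau heps.
have lr0 := log_ratio_ge0 htau heps.
set J := (\int[F]_z _)%E.
have J0 : (0 <= J)%E by apply: integral_ge0 => z _; exact: lr0.
have q0 := concentration_H_gt0 mT T_kernel hd (ltW lam0) htau heps hH.
have qE : concentration H eps = (fine (concentration H eps))%:E.
  rewrite fineK//; move: q0.
  by case: (concentration H eps) => [r| |] /=; rewrite ?ltxx.
(* for an infinite integral the claim rests on [Q(H, eps) > 0] *)
have [Jy|Jy] := eqVneq J +oo%E.
  rewrite Jy qE -EFinM gt0_muley ?lte_fin ?ltr0n// [expeR _]/=.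
  by rewrite gt0_muley ?leey// lte_fin mulr_gt0.
have Jfin : J \is a fin_num by rewrite ge0_fin_numE// ltey.
have ilr : F.-integrable [set: R] (log_ratio tau eps).
  apply/integrableP; split=> //.
  under eq_integral do rewrite gee0_abs//.
  by rewrite ltey.
have F0 : F [set 0] = 0%E.
  apply/(negligibleP _ (measurable_set1 0)).
  have := integrable_ae measurableT ilr.
  apply: negligibleS => z /= -> h; have := h I.
  by rewrite /log_ratio eqxx.
pose lw (z : R) : R := fine (log_ratio tau eps z).
have lw_le z : ((lw z)%:E <= log_ratio tau eps z)%E.
  rewrite /lw; have := lr0 z; case: (log_ratio tau eps z) => [r| |]//=.
have mlw : measurable_fun [set: R] (EFin \o lw).
  apply/measurable_EFinP.
  exact: (measurableT_comp (fine_measurable measurableT)).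
have ilw : F.-integrable [set: R] (EFin \o lw).
  apply: le_integrable ilr => // z _.
  have lw0 : (0 <= (lw z)%:E)%E by rewrite lee_fin fine_ge0.
  rewrite [leRHS]gee0_abs//; apply: le_trans (lw_le z).
  by rewrite -(gee0_abs lw0).
have LJ : \int[F]_z lw z <= fine J.
  rewrite -lee_fin (fineK Jfin) fineK; last exact: integrable_fin_num.
  apply: ge0_le_integral => // z _; rewrite lee_fin; exact: fine_ge0.
apply: ge_ereal_sup => _ [x _ <-].
apply: (le_trans (probability_ball_le mT T_kernel hd (ltW lam0)
  htau heps hH F0 ilw x hX FG)).
have -> : expeR (d%:R%:E * J)%E = (expR (d%:R * fine J))%:E.
  by rewrite -[in LHS](fineK Jfin).
rewrite qE -!EFinM lee_fin ler_pM2l ?mulr_gt0//.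
by rewrite ler_expR ler_wpM2l.
Qed.
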